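(* There exists a flexible polyhedron embedded in $\mathbb{R}^3$ with eight vertices and twelve triangular faces which arises from a Bricard type I octahedron by cutting and reflecting along a symmetric quadrilateral and then erecting a tent on one face. Precisely, there exist points $A,B,A',B',D,C',C,C'',T\in\mathbb{R}^3$ such that: (1) $A,B,A',B'$ are not collinear, $AB=A'B'$ and $A'B=AB'$; (2) $D\neq A'$, $DB=BA'$ and $DB'=B'A'$; (3) $C'$ lies on the ray from $A$ through $D$, with $D$ on the segment $AC'$; (4) $C$ is the image of $C'$ under a half-turn about a line that swaps $A$ with $A'$ and $B$ with $B'$; (5) $C''$ is the image of $C'$ under reflection in a plane that contains $B$ and $B'$ and swaps $D$ with $A'$; (6) if $S$ denotes the pentagonal bipyramid surface with apices $B$, $B'$ over the pentagon $A\,C\,A'\,C''\,D$, i.e. with the ten triangular faces $ABC$, $CBA'$, $A'BC''$, $C''BD$, $DBA$, $AB'C$, $CB'A'$, $A'B'C''$, $C''B'D$, $DB'A$, then for some face $F=XYZ$ of $S$ the surface $\widehat S$ obtained from $S$ by replacing $F$ with the three triangles $TXY$, $TYZ$, $TZX$ is an embedded polyhedral sphere in $\mathbb{R}^3$ (with eight vertices and twelve faces) and is flexible.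
   Context: All lengths such as $AB$ are Euclidean distances. A polyhedral surface with triangular faces is given by an abstract triangulation together with the positions of its vertices in $\mathbb{R}^3$. It is embedded if it has no self-intersections: the induced map of the triangulated surface into $\mathbb{R}^3$, affine on each face, is injective. An embedded polyhedron is flexible if there is a continuous motion of its vertices, starting from the given position, that keeps the length of every edge constant (so every face stays congruent to itself) and keeps the surface embedded, and that is not the restriction of a motion of $\mathbb{R}^3$ by isometries (some distance between two vertices changes). Erecting a tent on a triangular face means replacing that face by the other three faces of a tetrahedron having it as a face. The octahedron with vertices $A,B,A',B',C,C'$, in which the opposite pairs are $(A,A')$, $(B,B')$, $(C,C')$, is a Bricard type I octahedron. The surface $S$ is obtained from it by cutting along the quadrilateral $DB'A'B$, and reflecting the part containing $C'$ in the plane of symmetry of this quadrilateral. *)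

(* Defs.v *)
From HB Require Import structures.
From mathcomp Require Import all_boot all_order all_algebra.
From mathcomp Require Import all_classical all_reals all_analysis.

Set Implicit Arguments.
Unset Strict Implicit.
Unset Printing Implicit Defensive.

Import Order.TTheory GRing.Theory Num.Theory.
Import numFieldNormedType.Exports.

Local Open Scope classical_set_scope.
Local Open Scope ring_scope.

Notation E3 R := 'rV[R]_3.

Section Euclidean.
Variable R : realType.
Implicit Types (a b m u v x y : E3 R) (f : E3 R -> E3 R).

Definition dot u v : R := \sum_i u 0 i * v 0 i.

(* The norm `|_| that MathComp-Analysis puts on 'rV[R]_3 is the sup norm, hence
   this separate Euclidean distance; the two induce the same topology. *)
Definition eucl_dist x y : R := Num.sqrt (dot (x - y) (x - y)).

Definition unit_sphere : set (E3 R) := [set x | eucl_dist x 0 = 1].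

(* line a u and plane a m are a line and a plane only when u != 0, resp.
   m != 0; these conditions are imposed where the notions are used. *)
Definition line a u : set (E3 R) := [set a + t *: u | t in [set: R]].

Definition plane a m : set (E3 R) := [set x | dot (x - a) m = 0].

Definition collinear (X : set (E3 R)) : Prop :=
  exists a u, u != 0 /\ X `<=` line a u.

Definition segment a b : set (E3 R) :=
  [set a + t *: (b - a) | t in [set t : R | 0 <= t <= 1]].

Definition ray a b : set (E3 R) :=
  [set x | a != b /\ exists2 t : R, 0 <= t & x = a + t *: (b - a)].

(* Rotation by pi about line a u: x and its image have as midpoint the
   orthogonal projection a + (dot (x - a) u / dot u u) *: u of x. *)
Definition half_turn a u x : E3 R :=
  2 *: (a + (dot (x - a) u / dot u u) *: u) - x.

Definition reflection a m x : E3 R :=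
  x - (2 * (dot (x - a) m / dot m m)) *: m.

Definition swaps f x y : Prop := f x = y /\ f y = x.

End Euclidean.

Definition homeomorphic (X Y : topologicalType) (A : set X) (B : set Y) : Prop :=
  exists (f : X -> Y) (g : Y -> X),
    [/\ set_fun A B f, set_fun B A g,
        {in A, cancel f g}, {in B, cancel g f} &
        {within A, continuous f} /\ {within B, continuous g}].

(* An abstract triangulation on the vertices 0, ..., n - 1 is given by its set
   of faces, and vertex positions by a function p : 'I_n -> E3 R. *)
Section Surfaces.
Variables (R : realType) (n : nat).
Implicit Types (K : {set {set 'I_n}}) (F : {set 'I_n}) (p : 'I_n -> E3 R).

(* The abstract triangulated surface as a space: points are given by their
   barycentric coordinates with respect to all the vertices. *)
Definition realization K : set 'rV[R]_n :=
  [set w | [/\ forall i, 0 <= w 0 i, \sum_i w 0 i = 1 &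
              exists2 F, F \in K & forall i, i \notin F -> w 0 i = 0]].

Definition induced_map p (w : 'rV[R]_n) : E3 R := \sum_i w 0 i *: p i.

Definition embedded K p : Prop := set_inj (realization K) (induced_map p).

Definition triangulated_sphere K : Prop :=
  (forall F, F \in K -> #|F| = 3%N) /\
  homeomorphic (realization K) (@unit_sphere R).

Definition edge K (i j : 'I_n) : Prop :=
  i != j /\ exists2 F, F \in K & (i \in F) && (j \in F).

Definition flexible K p : Prop :=
  exists q : R -> 'I_n -> E3 R,
    [/\ forall i, q 0 i = p i,
        forall i, {within `[0, 1]%classic, continuous (fun t => q t i)},
        forall (t : R) i j, 0 <= t <= 1 -> edge K i j ->
          eucl_dist (q t i) (q t j) = eucl_dist (p i) (p j),
        forall t : R, 0 <= t <= 1 -> embedded K (q t) &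
        exists (t : R) i j, 0 <= t <= 1 /\
          eucl_dist (q t i) (q t j) <> eucl_dist (p i) (p j)].

Definition affinely_independent p (s : {set 'I_n}) : Prop :=
  forall c : 'I_n -> R,
    \sum_(i in s) c i = 0 -> \sum_(i in s) c i *: p i = 0 ->
    forall i, i \in s -> c i = 0.

Definition tetrahedron p (s : {set 'I_n}) : Prop :=
  #|s| = 4%N /\ affinely_independent p s.

(* For F = {X, Y, Z} the added faces are {T, Y, Z}, {T, X, Z}, {T, X, Y}. *)
Definition tent K F (T : 'I_n) : {set {set 'I_n}} :=
  ((K :\ F) :|: [set T |: (F :\ X) | X in F])%SET.

End Surfaces.

Definition vA : 'I_8 := @Ordinal 8 0 isT.
Definition vB : 'I_8 := @Ordinal 8 1 isT.
Definition vA' : 'I_8 := @Ordinal 8 2 isT.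
Definition vB' : 'I_8 := @Ordinal 8 3 isT.
Definition vC : 'I_8 := @Ordinal 8 4 isT.
Definition vC'' : 'I_8 := @Ordinal 8 5 isT.
Definition vD : 'I_8 := @Ordinal 8 6 isT.
Definition vT : 'I_8 := @Ordinal 8 7 isT.

Definition positions (R : realType) (A B A' B' C C'' D T : E3 R) :
    'I_8 -> E3 R :=
  tnth [tuple A; B; A'; B'; C; C''; D; T].

(* vT is not a vertex of the bipyramid; it is the apex of the tent. *)
Definition bipyramid : {set {set 'I_8}} :=
  [set:: [:: [set vA; vB; vC]; [set vC; vB; vA']; [set vA'; vB; vC''];
             [set vC''; vB; vD]; [set vD; vB; vA];
             [set vA; vB'; vC]; [set vC; vB'; vA']; [set vA'; vB'; vC''];
             [set vC''; vB'; vD]; [set vD; vB'; vA]]]%SET.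

(* Main.v *)
Require Import Defs.
From Stdlib Require Import BinInt.
From HB Require Import structures.
From mathcomp Require Import all_boot all_order all_algebra.
From mathcomp Require Import all_classical all_reals all_analysis.
From mathcomp Require Import ssrZ zify ring lra.

(** Flexing a Bricard octahedron of type I that is symmetric under the half-turn
    about the third axis amounts to moving three planar vectors and their heights
    while keeping six quadratic quantities fixed. With half of [BB'] as the
    parameter x, and y determined by [x * y = -125], the square of the height of
    B solves a quadratic equation, which gives an explicit motion. The lengths
    are chosen such that D, on the edge [AC'], has the same distances to B and B'
    as A'; the reflection swapping D and A' then moves along with the octahedron.
    At the start all vertices are integral, and the bipyramid has
    self-intersections only in the face [CBA'], which the tent avoids.

    Embeddedness is certified by a separating plane for every pair of faces; the
    certificates are strict inequalities between polynomials in the coordinates,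
    so they persist for small times, and on the unit time interval after
    rescaling. The abstract surface is a sphere because it is also the boundary
    complex of a convex polytope. *)

Set Implicit Arguments.
Unset Strict Implicit.
Unset Printing Implicit Defensive.

Import Order.TTheory GRing.Theory Num.Theory.
Import numFieldNormedType.Exports.

Local Open Scope classical_set_scope.
Local Open Scope ring_scope.

(** * Scalar product, continuity, homeomorphisms *)

Section Dot.
Variable R : realType.
Implicit Types u v w : E3 R.

Lemma dotC u v : dot u v = dot v u.
Proof. by apply: eq_bigr => i _; rewrite mulrC. Qed.

Lemma dotDl u v w : dot (u + v) w = dot u w + dot v w.
Proof.
by rewrite /dot -big_split; apply: eq_bigr => i _; rewrite mxE mulrDl.
Qed.

Lemma dotZl a u v : dot (a *: u) v = a * dot u v.
Proof.
by rewrite /dot mulr_sumr; apply: eq_bigr => i _; rewrite mxE mulrA.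
Qed.

Lemma dot0l v : dot 0 v = 0.
Proof. by rewrite -(scale0r 0) dotZl mul0r. Qed.

Lemma dotNl u v : dot (- u) v = - dot u v.
Proof. by rewrite -scaleN1r dotZl mulN1r. Qed.

Lemma dotBl u v w : dot (u - v) w = dot u w - dot v w.
Proof. by rewrite dotDl dotNl. Qed.

Lemma dotZr a u v : dot u (a *: v) = a * dot u v.
Proof. by rewrite dotC dotZl dotC. Qed.

Lemma dotNr u v : dot u (- v) = - dot u v.
Proof. by rewrite dotC dotNl dotC. Qed.

Lemma dotBr u v w : dot u (v - w) = dot u v - dot u w.
Proof. by rewrite !(dotC u) dotBl. Qed.

Lemma dot_suml (I : Type) (r : seq I) (P : pred I) (F : I -> E3 R) v :
  dot (\sum_(i <- r | P i) F i) v = \sum_(i <- r | P i) dot (F i) v.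
Proof.
by elim/big_rec2: _ => [|i x y _ <-]; rewrite ?dot0l ?dotDl.
Qed.

Lemma dot_ge0 u : 0 <= dot u u.
Proof. by apply: sumr_ge0 => i _; rewrite -expr2 sqr_ge0. Qed.

Lemma dot_eq0 u : (dot u u == 0) = (u == 0).
Proof.
apply/eqP/eqP => [h|->]; last exact: dot0l.
apply/rowP => i; rewrite mxE.
have := @psumr_eq0P _ _ predT (fun i => u 0 i * u 0 i) _ h i isT.
move=> /(_ (fun i _ => _)) => /(_ ltac:(by move=> j; rewrite -expr2 sqr_ge0)).
by move/eqP; rewrite -expr2 sqrf_eq0 => /eqP.
Qed.

Lemma dot_inord u v : dot u v =
  u 0 (inord 0) * v 0 (inord 0) + u 0 (inord 1) * v 0 (inord 1) +
  u 0 (inord 2) * v 0 (inord 2).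
Proof.
rewrite /dot !big_ord_recl big_ord0 addr0 addrA.
by congr (u _ _ * v _ _ + u _ _ * v _ _ + u _ _ * v _ _);
  apply/val_inj; rewrite /= inordK.
Qed.

Lemma eucl_dist0 u : eucl_dist u 0 = Num.sqrt (dot u u).
Proof. by rewrite /eucl_dist subr0. Qed.

Lemma eucl_dist0_gt0 u : u != 0 -> 0 < eucl_dist u 0.
Proof. by move=> u0; rewrite eucl_dist0 sqrtr_gt0 lt_def dot_eq0 u0 dot_ge0. Qed.

Lemma eucl_dist0Z a u : 0 <= a -> eucl_dist (a *: u) 0 = a * eucl_dist u 0.
Proof.
move=> a0; rewrite !eucl_dist0 dotZl dotZr mulrA -expr2.
by rewrite sqrtrM ?sqr_ge0// sqrtr_sqr ger0_norm.
Qed.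

End Dot.

Lemma continuous_sum (R : realType) (V : normedModType R) (T : topologicalType)
    (I : Type) (r : seq I) (P : pred I) (F : I -> T -> V) (x : T) :
  (forall i, P i -> {for x, continuous (F i)}) ->
  {for x, continuous (fun t => \sum_(i <- r | P i) F i t)}.
Proof.
by move=> cF; apply: (cvg_big add_continuous) => i Pi; exact: cF.
Qed.

Lemma continuous_coord (R : realType) m n (T : topologicalType)
    (f : T -> 'M[R]_(m, n)) (x : T) i j :
  {for x, continuous f} -> {for x, continuous (fun t => f t i j)}.
Proof. by move=> cf; apply: cvg_comp cf (@coord_continuous _ _ _ i j _). Qed.

Lemma continuous_dot (R : realType) (T : topologicalType) (f g : T -> E3 R)
    (x : T) :
  {for x, continuous f} -> {for x, continuous g} ->
  {for x, continuous (fun t => dot (f t) (g t))}.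
Proof.
move=> cf cg; apply: (@continuous_sum R R^o) => i _.
by apply: continuousM; apply: continuous_coord.
Qed.

(** Closed subsets of the compact [A] have compact, hence closed, images in the Hausdorff space [Y];
    this is continuity of the inverse. *)
Lemma compact_homeomorphic (X Y : topologicalType) (A : set X) (B : set Y)
    (f : X -> Y) :
  hausdorff_space Y -> compact A -> A !=set0 -> {within A, continuous f} ->
  set_inj A f -> f @` A = B -> homeomorphic A B.
Proof.
move=> hY cA [a0 Aa0] cf injf fAB.
(* The inverse must be a total function; outside [B] it takes the default value [a0]. *)
have inv y : exists x, B y -> A x /\ f x = y.
  have [By|nBy] := pselect (B y); last by exists a0.
  by move: By; rewrite -fAB => -[x Ax xy]; exists x => _; split.
have [g gP] := choice inv.
exists f, g; split.
- by move=> x Ax; rewrite -fAB; exists x.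
- by move=> y /gP[].
- move=> x; rewrite inE => Ax.
  have [|Agf fgf] := gP (f x); first by rewrite -fAB; exists x.
  by apply: injf; rewrite ?inE.
- by move=> y; rewrite inE => /gP[].
split=> //; apply/continuous_closedP => C cC; apply/closed_subspaceP.
exists (f @` (C `&` A)).
  apply: compact_closed => //; apply: continuous_compact.
    by apply: continuous_subspaceW cf => x [].
  by rewrite setIC; apply: compact_closedI.
rewrite eqEsubset; split=> y [].
- move=> [x [Cx Ax] xy] By; split=> //=.
  have [Agy fgy] := gP y By.
  have gyx : g y = x by apply: injf; rewrite ?inE// xy.
  by rewrite -gyx in Cx.
- move=> Cgy By; split=> //; have [Agy fgy] := gP y By.
  by exists (g y).
Qed.

(** * Boundary complexes of convex polytopes *)

Lemma continuous_induced_map (R : realType) n (p : 'I_n -> E3 R) :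
  continuous (induced_map p).
Proof.
move=> w; apply: continuous_sum => i _.
apply: (@continuousZr_tmp _ _ _ (fun v : 'rV[R]_n => v 0 i)).
exact: coord_continuous.
Qed.

(** The realization is a closed subset of the cube with side [0, 1]: a finite union, over the faces,
    of sets cut out by linear equations. The bound 1 on each coordinate follows from nonnegativity
    and the sum 1. *)
Lemma realization_compact (R : realType) n (K : {set {set 'I_n}}) :
  compact (@realization R n K).
Proof.
have -> : @realization R n K = [set w | (forall i, `[0 : R, 1]%classic (w ord0 i))] `&`
    ([set w | \sum_i w 0 i = 1] `&`
     \bigcup_(F in [set F | F \in K]) \bigcap_(i in [set i | i \notin F])
        [set w | w 0 i = 0]).
  rewrite eqEsubset; split=> [w [w0 w1 [F KF wF]]|w [w01 [w1 [F KF wF]]]].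
    split=> [i|]; last by split=> //; exists F.
    rewrite /= in_itv/= w0/= -w1 (bigD1 i)//= lerDl.
    by apply: sumr_ge0 => j _; exact: w0.
  split=> // [i|]; last by exists F => // i iF; exact: wF.
  by have := w01 i; rewrite /= in_itv/= => /andP[].
apply: compact_closedI.
  exact: (@rV_compact R n (fun=> `[0 : R, 1]%classic) (fun=> @segment_compact R 0 1)).
apply: closedI.
  apply: (@preimage_closed _ _ (fun w : 'rV[R]_n => \sum_i w 0 i) [set x | x = 1]).
    by move=> w _; apply: (@continuous_sum R R^o) => i _; exact: coord_continuous.
  exact: closed_eq.
apply: closed_bigcup => [|F _]; first exact: finite_finset.
apply: closed_bigI => i _.
apply: (@preimage_closed _ _ (fun w : 'rV[R]_n => w 0 i) [set x | x = 0]).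
  by move=> w _; exact: coord_continuous.
exact: closed_eq.
Qed.

Section ConvexPolytope.
Variables (R : realType) (n : nat) (K : {set {set 'I_n}}).
Variables (V : 'I_n -> E3 R) (nu : {set 'I_n} -> E3 R).

(* [dot x (nu F) <= 1] are the facets of a convex polytope with the origin in
   its interior; [facet_adj] says that facets meet along each edge. *)
Hypothesis K_gt0 : exists F, F \in K.
Hypothesis card_facet : forall F, F \in K -> #|F| = 3%N.
Hypothesis facet_eq : forall F i, F \in K -> i \in F -> dot (V i) (nu F) = 1.
Hypothesis facet_lt :
  forall F i, F \in K -> i \notin F -> dot (V i) (nu F) < 1.
Hypothesis facet_adj : forall F i, F \in K -> i \in F ->
  exists G, [/\ G \in K, i \notin G & forall j, j \in F -> j != i -> j \in G].

Let Y := induced_map V.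

Let dotY w v : dot (Y w) v = \sum_i w 0 i * dot (V i) v.
Proof. by rewrite dot_suml; apply: eq_bigr => i _; rewrite dotZl. Qed.

Let facet_le F i : F \in K -> dot (V i) (nu F) <= 1.
Proof.
move=> KF; have [iF|iF] := boolP (i \in F); first by rewrite facet_eq.
exact/ltW/facet_lt.
Qed.

Let dotY_le w F : realization K w -> F \in K -> dot (Y w) (nu F) <= 1.
Proof.
move=> [w0 w1 _] KF; rewrite dotY -w1; apply: ler_sum => i _.
by rewrite ler_piMr// facet_le.
Qed.

Let dotY_eq w F : realization K w -> F \in K ->
  (forall i, i \notin F -> w 0 i = 0) -> dot (Y w) (nu F) = 1.
Proof.
move=> [w0 w1 _] KF wF; rewrite dotY -w1; apply: eq_bigr => i _.
have [iF|/wF->] := boolP (i \in F); last by rewrite mul0r.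
by rewrite facet_eq// mulr1.
Qed.

(** A weighted average of numbers that are at most 1 equals 1 only if all the weight lies where the
    number is 1, that is, on the vertices of [F]. *)
Let dotY_eqP w F : realization K w -> F \in K -> dot (Y w) (nu F) = 1 ->
  forall i, i \notin F -> w 0 i = 0.
Proof.
move=> [w0 w1 _] KF; rewrite dotY -w1 => /eqP; rewrite eq_sym -subr_eq0 -sumrB.
move=> /eqP /psumr_eq0P h i iF.
have := h (fun i _ => _) i isT.
move=> /(_ ltac:(by move=> j; rewrite subr_ge0 ler_piMr// facet_le)) /eqP.
rewrite -[X in X - _]mulr1 -mulrBr mulf_eq0 subr_eq0 => /orP[/eqP//|/eqP e].
by have := facet_lt KF iF; rewrite -e ltxx.
Qed.

(** Let [G] be the facet adjacent to [F] opposite to [i]. Pairing the relation with [nu F - nu G]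
    kills every vertex of [F] except [i], so the coefficient of [i] vanishes. *)
Let facet_free F (z : 'I_n -> R) : F \in K -> (forall i, i \notin F -> z i = 0) ->
  \sum_i z i *: V i = 0 -> forall i, z i = 0.
Proof.
move=> KF zF zV i; have [iF|/zF//] := boolP (i \in F).
have [G [KG iG FG]] := facet_adj KF iF.
have := congr1 (fun x => dot x (nu F - nu G)) zV.
rewrite dot0l dot_suml (bigD1 i)//= big1 ?addr0 => [|j ji].
  rewrite dotZl dotBr facet_eq// => /eqP; rewrite mulf_eq0 subr_eq0.
  move=> /orP[/eqP//|/eqP e].
  by have := facet_lt KG iG; rewrite -e ltxx.
have [jF|/zF->] := boolP (j \in F); last by rewrite scale0r dot0l.
by rewrite dotZl dotBr !facet_eq ?subrr ?mulr0// FG.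
Qed.

Let Y_neq0 w : realization K w -> Y w != 0.
Proof.
move=> Kw; have [_ _ [F KF wF]] := Kw.
apply/eqP => Yw; have := dotY_eq Kw KF wF.
by rewrite Yw dot0l => /esym/eqP; rewrite oner_eq0.
Qed.

(** Each point lies on the plane of its own facet and not beyond that of the other, which forces
    [l = 1]. Then [w'] too is supported on the facet of [w], where the vertices are linearly
    independent. *)
Let Y_ray_inj w w' l : realization K w -> realization K w' -> 0 < l ->
  Y w = l *: Y w' -> w = w'.
Proof.
move=> Kw Kw' l0 e; have [_ _ [F KF wF]] := Kw; have [_ _ [F' KF' wF']] := Kw'.
have l1 : l = 1.
  apply/eqP; rewrite eq_le; apply/andP; split.
    have := dotY_le Kw KF'; rewrite e dotZl dotY_eq//.
    by rewrite mulr1.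
  have := dotY_eq Kw KF wF; rewrite e dotZl => <-.
  by rewrite ler_piMr ?(ltW l0)// dotY_le.
rewrite l1 scale1r in e.
have w'F : forall i, i \notin F -> w' 0 i = 0.
  by apply: dotY_eqP => //; rewrite -e dotY_eq.
apply/rowP => i; apply/eqP; rewrite -subr_eq0; apply/eqP.
apply: (@facet_free F (fun i => w 0 i - w' 0 i)) => // [j jF|].
  by rewrite wF// w'F// subrr.
under eq_bigr do rewrite scalerBl.
by rewrite sumrB; apply/eqP; rewrite subr_eq0; apply/eqP.
Qed.

(* On the facet F maximising [dot x (nu F)], the coordinates of x in the basis
   (V i)_(i in F) are nonnegative: the i-th one is a positive multiple of
   [dot x (nu F - nu G)] where G is the facet adjacent to F opposite to i. *)
Let Y_surj x : x != 0 -> exists2 w, realization K w & exists2 l, 0 < l & x = l *: Y w.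
Proof.
move=> x0; have [F0 KF0] := K_gt0.
have [F KF Fmax] : exists2 F, F \in K & forall G, G \in K -> dot x (nu G) <= dot x (nu F).
  by case: (@arg_maxP _ _ _ F0 (mem K) (fun F => dot x (nu F)) KF0) => F KF h; exists F.
have exG i : exists G, i \in F ->
    [/\ G \in K, i \notin G & forall j, j \in F -> j != i -> j \in G].
  have [iF|_] := boolP (i \in F); last by exists F.
  by have [G ?] := facet_adj KF iF; exists G.
have [G GP] := choice exG.
(* For [i] in [F] these vectors form the basis dual to the vertices of [F]. *)
pose e i := (1 - dot (V i) (nu (G i)))^-1 *: (nu F - nu (G i)).
have ge0 i : i \in F -> 0 < 1 - dot (V i) (nu (G i)).
  by move=> /GP[KG iG _]; rewrite subr_gt0 facet_lt.
have eV i j : i \in F -> j \in F -> dot (V j) (e i) = (i == j)%:R.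
  move=> iF jF; have [KG iG GF] := GP i iF; rewrite dotZr dotBr (facet_eq KF jF).
  have [<-|ij] := eqVneq i j; first by rewrite mulVf// gt_eqF// ge0.
  by rewrite (facet_eq KG (GF _ jF _)) ?subrr ?mulr0// eq_sym.
pose c i := if i \in F then dot x (e i) else 0.
have c0 i : 0 <= c i.
  rewrite /c; case: ifPn => // iF; rewrite dotZr dotBr mulr_ge0//.
    by rewrite invr_ge0 ltW// ge0.
  by rewrite subr_ge0 Fmax//; have [] := GP i iF.
have xE : x = \sum_i c i *: V i.
  pose f (k : 'I_3) : 'I_n := enum_val (cast_ord (esym (card_facet KF)) k).
  have fF k : f k \in F by exact: enum_valP.
  pose M : 'M[R]_3 := \matrix_(k, l) V (f k) 0 l.
  pose E : 'M[R]_3 := \matrix_(l, k) e (f k) 0 l.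
  have ME : M *m E = 1%:M.
    apply/matrixP => k l; rewrite !mxE.
    transitivity (dot (V (f k)) (e (f l))).
      by apply: eq_bigr => m _; rewrite !mxE.
    rewrite eV// eq_sym; congr (_%:R); congr nat_of_bool.
    by rewrite /f (inj_eq enum_val_inj) (inj_eq (@cast_ord_inj _ _ _)).
  (* For square matrices [M *m E = 1] gives [E *m M = 1], and x = x E M is the expansion of x in the
     vertices of [F]. *)
  have -> : x = \sum_k dot x (e (f k)) *: V (f k).
    rewrite -[LHS]mulmx1 -(mulmx1C ME) mulmxA.
    apply/rowP => l; rewrite !mxE summxE; apply: eq_bigr => k _; rewrite !mxE.
    by congr (_ * _); apply: eq_bigr => m _; rewrite !mxE.
  rewrite [RHS](bigID (mem F))/= [X in _ = _ + X]big1 ?addr0; last first.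
    by move=> i /negbTE iF; rewrite /c iF scale0r.
  rewrite [RHS]big_enum_val [LHS](reindex (cast_ord (card_facet KF)))/=; last first.
    by exists (cast_ord (esym (card_facet KF))) => i _; rewrite ?cast_ordK ?cast_ordKV.
  by apply: eq_bigr => k _; rewrite /f cast_ordK /c enum_valP.
(* Dividing by the sum turns the nonnegative coordinates into barycentric ones; the sum itself is
   the scaling factor along the ray. *)
pose S := \sum_i c i.
have S0 : 0 < S.
  rewrite lt_def sumr_ge0// andbT; apply/eqP => S0.
  move/eqP: x0; apply; rewrite xE big1// => i _.
  by rewrite (@psumr_eq0P _ _ predT c _ S0 i isT) ?scale0r.
exists (\row_i (c i / S)); last first.
  exists S => //; rewrite /Y /induced_map xE scaler_sumr.
  apply: eq_bigr => i _; rewrite mxE scalerA mulrCA divff ?mulr1//.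
  by rewrite gt_eqF.
split=> [i||].
- by rewrite mxE divr_ge0// ltW.
- under eq_bigr do rewrite mxE.
  by rewrite -mulr_suml divff// gt_eqF.
- by exists F => // i /negbTE iF; rewrite mxE /c iF mul0r.
Qed.

(** Radial projection from the origin maps the boundary of the polytope bijectively to the unit
    sphere, since every ray meets the boundary exactly once; compactness makes it a
    homeomorphism. *)
Lemma convex_polytope_sphere : triangulated_sphere R K.
Proof.
split=> //.
pose r w := eucl_dist (Y w) 0.
have r0 w : realization K w -> 0 < r w.
  by move=> Kw; apply: eucl_dist0_gt0; exact: Y_neq0.
apply: (@compact_homeomorphic _ _ _ _ (fun w => (r w)^-1 *: Y w)).
- exact: norm_hausdorff.
- exact: realization_compact.
(* The realization is nonempty because some nonzero vector exists and its ray meets the boundary. *)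
- pose x : E3 R := const_mx 1.
  have [|w Kw _] := @Y_surj x; last by exists w.
  by apply/eqP => /rowP/(_ 0); rewrite !mxE => /eqP; rewrite oner_eq0.
- apply: continuous_in_subspaceT => w; rewrite inE => Kw.
  have cY : {for w, continuous Y} by exact: continuous_induced_map.
  apply: (@continuousZ _ _ _ (fun v => (r v)^-1) Y) => //.
  apply: continuousV; first by rewrite gt_eqF// r0.
  have -> : r = Num.sqrt \o (fun w => dot (Y w) (Y w)).
    by apply/funext => v; rewrite /r eucl_dist0.
  by apply: continuous_comp; [exact: continuous_dot | exact: sqrt_continuous].
- move=> w w'; rewrite !inE => Kw Kw' e.
  apply: (@Y_ray_inj w w' (r w / r w')) => //; first by rewrite divr_gt0// r0.
  by rewrite -scalerA -e scalerA divff ?scale1r// gt_eqF// r0.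
- rewrite eqEsubset; split=> [_ [w Kw <-]|x x1].
    rewrite /unit_sphere /= eucl_dist0Z ?invr_ge0 ?ltW ?r0//.
    by rewrite mulVf// gt_eqF// r0.
  have [|w Kw [l l0 xE]] := @Y_surj x.
    apply/eqP => x0; move: x1; rewrite x0 /unit_sphere /= eucl_dist0 dot0l sqrtr0.
    by move=> /esym/eqP; rewrite oner_eq0.
  exists w => //; move: x1; rewrite /unit_sphere/= xE eucl_dist0Z ?ltW// -/(r w) => lr.
  by congr (_ *: _); rewrite -[LHS]mul1r -lr mulfK// gt_eqF// r0.
Qed.

End ConvexPolytope.

(** * Embeddedness from separating planes *)

Section Certificates.
Variables (R : realType) (n : nat) (K : {set {set 'I_n}}) (p : 'I_n -> E3 R).

(** These are the values at the vertices of an affine function on space whose zero plane meets each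
    of the two triangles only in the convex hull of their common vertices. *)
Definition separates (F G : {set 'I_n}) (h : 'I_n -> R) : Prop :=
  [/\ exists v c, forall i, h i = dot (p i) v + c,
      forall i, i \in F -> i \notin G -> 0 < h i,
      forall i, i \in G -> i \notin F -> h i < 0 &
      forall i, i \in F -> i \in G -> h i = 0].

Lemma separatesC F G h : separates F G h -> separates G F (fun i => - h i).
Proof.
move=> [[v [c hE]] hp hn h0]; split=> [|i iG iF|i iF iG|i iG iF].
- by exists (- v), (- c) => i; rewrite hE dotNr opprD.
- by rewrite oppr_gt0 hn.
- by rewrite oppr_lt0 hp.
- by rewrite h0 ?oppr0.
Qed.

Hypothesis sep : forall F G, F \in K -> G \in K -> F != G ->
  exists h, separates F G h.
Hypothesis adj : forall F i, F \in K -> i \in F ->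
  exists G, [/\ G \in K, i \notin G & forall j, j \in F -> j != i -> j \in G].

Let affine_sum0 v c (z : 'I_n -> R) : \sum_i z i = 0 ->
  \sum_i z i *: p i = 0 -> \sum_i z i * (dot (p i) v + c) = 0.
Proof.
move=> z0 zp; under eq_bigr do rewrite mulrDr -dotZl.
by rewrite big_split/= -dot_suml zp dot0l -mulr_suml z0 mul0r addr0.
Qed.

(** Nondegeneracy of the faces needs no certificate of its own: the function separating [F] from its
    neighbour opposite to [i] vanishes at the vertices of [F] other than [i], but not at [i]. *)
Let face_free F (z : 'I_n -> R) : F \in K -> (forall i, i \notin F -> z i = 0) ->
  \sum_i z i = 0 -> \sum_i z i *: p i = 0 -> forall i, z i = 0.
Proof.
move=> KF zF z0 zp i; have [iF|/zF//] := boolP (i \in F).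
have [G [KG iG FG]] := adj KF iF.
have FneG : F != G by apply: contraNneq iG => <-.
have [h [[v [c hE]] hp _ h0]] := sep KF KG FneG.
have := affine_sum0 v c z0 zp; rewrite (bigD1 i)//= big1 ?addr0 => [|j ji].
  move/eqP; rewrite -hE mulf_eq0 => /orP[/eqP//|/eqP e].
  by have := hp i iF iG; rewrite e ltxx.
rewrite -hE; have [jF|/zF->] := boolP (j \in F); last by rewrite mul0r.
by rewrite h0 ?mulr0// FG.
Qed.

Lemma separated_embedded : embedded K p.
Proof.
move=> w w'; rewrite !inE => -[w0 w1 [F KF wF]] [w'0 w'1 [G KG wG]] e.
pose z i := w 0 i - w' 0 i.
have z0 : \sum_i z i = 0 by rewrite sumrB w1 w'1 subrr.
have zp : \sum_i z i *: p i = 0.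
  under eq_bigr do rewrite scalerBl.
  by rewrite sumrB; apply/eqP; rewrite subr_eq0; apply/eqP.
have zF i : i \notin F -> z i = 0.
  move=> iF; have [eFG|FneG] := eqVneq F G.
    by rewrite /z wF// wG ?subrr// -eFG.
  have [h [[v [c hE]] hp hn h0]] := sep KF KG FneG.
  (* On [F] alone both factors are nonnegative, on [G] alone both are nonpositive. These products
     sum to 0, so each vanishes, and [w'] has no weight outside [F]. *)
  have zh j : 0 <= z j * h j.
    have [jF|jF] := boolP (j \in F); have [jG|jG] := boolP (j \in G).
    - by rewrite h0// mulr0.
    - by rewrite /z (wG j)// subr0 mulr_ge0// ltW// hp.
    - by rewrite /z (wF j)// sub0r mulNr -mulrN mulr_ge0// oppr_ge0 ltW// hn.
    - by rewrite /z wF// wG// subrr mul0r.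
  have := affine_sum0 v c z0 zp; under eq_bigr do rewrite -hE.
  move/(psumr_eq0P (fun j _ => zh j))/(_ i isT)/eqP.
  have [iG|iG _] := boolP (i \in G); last by rewrite /z wF// wG// subrr.
  rewrite mulf_eq0 => /orP[/eqP//|/eqP hi].
  by have := hn i iG iF; rewrite hi ltxx.
apply/rowP => i; apply/eqP; rewrite -subr_eq0; apply/eqP.
exact: face_free zF z0 zp i.
Qed.

End Certificates.

(** * Complexes given by lists of numbers *)

Definition face n (s : seq nat) : {set 'I_n} := [set i : 'I_n | (i : nat) \in s]%SET.

Lemma enum_face n s :
  map (@nat_of_ord n) (enum (face n s)) = [seq k <- iota 0 n | k \in s].
Proof.
rewrite -val_enum_ord filter_map /enum_mem -filter_predI; congr map.
by apply: eq_filter => i /=; rewrite inE andbT.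
Qed.

Lemma card_face n s : #|face n s| = count (mem s) (iota 0 n).
Proof. by rewrite cardE -(size_map (@nat_of_ord n)) enum_face size_filter. Qed.

Definition complex n (fs : seq (seq nat)) : {set {set 'I_n}} :=
  [set:: [seq face n s | s <- fs]]%SET.

Lemma complexP n fs F :
  reflect (exists2 s, s \in fs & F = face n s) (F \in complex n fs).
Proof. by rewrite inE; exact: mapP. Qed.

Lemma face_complex n fs s : s \in fs -> face n s \in complex n fs.
Proof. by move=> sfs; apply/complexP; exists s. Qed.

Lemma card_complex n fs :
  uniq [seq [seq k <- iota 0 n | k \in s] | s <- fs] ->
  #|complex n fs| = size fs.
Proof.
move=> fsu; rewrite /complex cardsE (card_uniqP _) ?size_map//.
apply: (@map_uniq _ _ (fun F : {set 'I_n} => map (@nat_of_ord n) (enum F))).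
by rewrite -map_comp (eq_map (@enum_face n)).
Qed.

(** Computable form of the adjacency hypothesis shared by the polytope criterion and the embedding
    criterion. *)
Definition edge_adjacent (fs : seq (seq nat)) : bool :=
  all (fun s => all (fun i => has (fun t =>
    (i \notin t) && all (fun j => (j == i) || (j \in t)) s) fs) s) fs.

Lemma edge_adjacentP n fs : edge_adjacent fs -> forall F (i : 'I_n),
  F \in complex n fs -> i \in F -> exists G,
  [/\ G \in complex n fs, i \notin G & forall j, j \in F -> j != i -> j \in G].
Proof.
move=> /allP adj F i /complexP[s sfs ->]; rewrite inE => si.
have /allP/(_ _ si)/hasP[t tfs /andP[it /allP st]] := adj s sfs.
exists (face n t); split; rewrite ?face_complex ?inE// => j.
by rewrite !inE => /st /orP[/eqP/val_inj->|//]; rewrite eqxx.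
Qed.

(** * Integer certificates for separating planes *)

Definition Zto (S : pzRingType) (z : Z) : S := (int_of_Z z)%:~R.

HB.instance Definition _ (S : pzRingType) := GRing.RMorphism.copy (@Zto S)
  (intmul 1 \o int_of_Z).

Lemma Zto_gt0 (S : numDomainType) z : (0 < Zto S z) = (0 < z).
Proof. by rewrite /Zto ltr0z; case: z => // p; rewrite /= ltz_nat; lia. Qed.

Lemma Zto_lt0 (S : numDomainType) z : (Zto S z < 0) = (z < 0).
Proof. by rewrite -oppr_gt0 -rmorphN Zto_gt0 oppr_gt0. Qed.

(* [Flat a m c] is the function m . (x - p_a) + c of the point x, and
   [Hinge a b m] is det (m, p_b - p_a, x - p_a). *)
Inductive certificate :=
  | Flat of nat & seq Z & Z
  | Hinge of nat & nat & seq Z.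

Section CertificateValue.
Variables (S : pzRingType) (X : nat -> nat -> S).
Implicit Type c : certificate.

Definition cert_base c := match c with Flat a _ _ | Hinge a _ _ => a end.

Definition cert_offset c : S := match c with Flat _ _ z => Zto S z | _ => 0 end.

Definition cert_normal c (j : nat) : S :=
  match c with
  | Flat _ m _ => Zto S (nth 0 m j)
  | Hinge a b m =>
    let d k := X b k - X a k in
    let m k := Zto S (nth 0 m k) in
    match j with
    | 0 => m 1%N * d 2%N - m 2%N * d 1%N
    | 1 => m 2%N * d 0%N - m 0%N * d 2%N
    | _ => m 0%N * d 1%N - m 1%N * d 0%N
    end
  end.

Definition cert_val c (i : nat) : S :=
  let y k := cert_normal c k * (X i k - X (cert_base c) k) in
  y 0%N + y 1%N + y 2%N + cert_offset c.

End CertificateValue.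

(** Zeros are read off from the shape of the certificate, so they hold for all positions of the
    vertices and survive any motion. A [Hinge] plane turns with the edge that two faces share. *)
Definition cert_zero c (i : nat) : bool :=
  match c with
  | Flat a _ z => (i == a) && (z == 0)
  | Hinge a b _ => (i == a) || (i == b)
  end.

Definition cert_check (S : numDomainType) (X : nat -> nat -> S)
    (x : seq nat * seq nat * certificate) : bool :=
  let: (s, t, c) := x in
  [&& all (fun i => (i \in t) || (0 < cert_val X c i)) s,
      all (fun i => (i \in s) || (cert_val X c i < 0)) t &
      all (fun i => (i \notin t) || cert_zero c i) s].

Lemma cert_val_zero (S : comPzRingType) (X : nat -> nat -> S) c i :
  cert_zero c i -> cert_val X c i = 0.
Proof.
case: c => [a m z /andP[/eqP-> /eqP->]|a b m /orP[]/eqP->]; rewrite /cert_val/=.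
- by rewrite !subrr !mulr0 !addr0 /Zto.
- by rewrite !subrr !mulr0 !addr0.
- by ring.
Qed.

Lemma cert_val_Zto (S : pzRingType) (X : nat -> nat -> Z) c i :
  cert_val (fun i j => Zto S (X i j)) c i = Zto S (cert_val X c i).
Proof.
have ZtoZ z : Zto Z z = z by rewrite /Zto; lia.
rewrite /cert_val; case: c => [a m z|a b m] /=;
by rewrite !(ZtoZ, rmorphD, rmorphM, rmorphN, rmorph0).
Qed.

Lemma cert_check_Zto (S : numDomainType) (X : nat -> nat -> Z) x :
  cert_check X x -> cert_check (fun i j => Zto S (X i j)) x.
Proof.
case: x => [[s t] c] /and3P[h1 h2 h3]; apply/and3P; split=> //.
  by apply: sub_all h1 => i; rewrite cert_val_Zto Zto_gt0.
by apply: sub_all h2 => i; rewrite cert_val_Zto Zto_lt0.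
Qed.

Definition all_pairs_certified (fs : seq (seq nat))
    (cs : seq (seq nat * seq nat * certificate)) : bool :=
  all (fun s => all (fun t => (s == t) ||
    has (fun x => (x.1 == (s, t)) || (x.1 == (t, s))) cs) fs) fs.

Definition coords (R : realType) n (p : 'I_n.+1 -> E3 R) (i j : nat) : R :=
  p (inord i) 0 (inord j).

Lemma cert_separates (R : realType) n (p : 'I_n.+1 -> E3 R) s t c :
  cert_check (coords p) (s, t, c) ->
  separates p (face n.+1 s) (face n.+1 t) (fun i => cert_val (coords p) c i).
Proof.
move=> /and3P[/allP hp /allP hn /allP h0]; split=> [|i|i|i]; rewrite ?inE.
- pose v : E3 R := \row_j cert_normal (coords p) c j.
  exists v, (cert_offset R c - dot (p (inord (cert_base c))) v) => i.
  by rewrite !dot_inord !mxE !inordK// /cert_val /coords inord_val; ring.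
- by move=> si ti; have := hp i si; rewrite (negbTE ti).
- by move=> ti si; have := hn i ti; rewrite (negbTE si).
- by move=> si ti; apply: cert_val_zero; have := h0 i si; rewrite ti.
Qed.

Lemma certified_embedded (R : realType) n fs cs (p : 'I_n.+1 -> E3 R) :
  edge_adjacent fs -> all_pairs_certified fs cs ->
  all (cert_check (coords p)) cs -> embedded (complex n.+1 fs) p.
Proof.
move=> adj /allP pairs chk; apply: separated_embedded; last exact: edge_adjacentP.
move=> _ _ /complexP[s sfs ->] /complexP[t tfs ->] st.
have /allP/(_ _ tfs)/orP[/eqP e|] := pairs s sfs; first by rewrite e eqxx in st.
elim: cs chk {pairs} => //= -[[s' t'] c] cs IH /andP[chk /IH{}IH].
move=> /orP[/orP[]/eqP[]|//] e1 e2; move: chk; rewrite e1 e2 => /cert_separates h.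
  by exists (fun i => cert_val (coords p) c i).
by exists (fun i => - cert_val (coords p) c i); exact: separatesC.
Qed.

Lemma near_all (T : Type) (U : topologicalType) (x : U) (P : U -> pred T)
    (Q : pred T) (s : seq T) :
  (forall a, Q a -> \forall t \near x, P t a) -> all Q s ->
  \forall t \near x, all (P t) s.
Proof.
move=> PQ; elim: s => [_|a s IH /= /andP[/PQ Qa /IH Qs]]; first exact: nearW.
by apply: filterS2 Qa Qs => t /= -> ->.
Qed.

Lemma continuous_cert_val (R : realType) n (T : topologicalType)
    (q : T -> 'I_n.+1 -> E3 R) (x : T) c i :
  (forall i, {for x, continuous (q^~ i)}) ->
  {for x, continuous (fun t => cert_val (coords (q t)) c i)}.
Proof.
move=> cq; have cX k l : {for x, continuous (fun t => coords (q t) k l)}.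
  exact: continuous_coord.
have cB k l m : {for x, continuous (fun t => coords (q t) k m - coords (q t) l m)}.
  exact: (@continuousB R R^o).
have cst (y : R) : {for x, continuous (fun=> y)} by exact: cst_continuous.
have cN k : {for x, continuous (fun t => cert_normal (coords (q t)) c k)}.
  case: c => [a m z|a b m] /=; first exact: cst.
  by case: k => [|[|k]]; apply: (@continuousB R R^o); apply: continuousM.
by apply: (@continuousD R R^o) => //; apply: (@continuousD R R^o) => //;
  [apply: (@continuousD R R^o)|]; apply: continuousM.
Qed.

(** The sign conditions are finitely many strict inequalities between continuous functions, and the
    condition on zeros does not involve the positions. *)
Lemma near_cert_check (R : realType) n (T : topologicalType)
    (q : T -> 'I_n.+1 -> E3 R) (x : T) y :
  (forall i, {for x, continuous (q^~ i)}) -> cert_check (coords (q x)) y ->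
  \forall t \near x, cert_check (coords (q t)) y.
Proof.
case: y => [[s t] c] cq /and3P[hp hn h0].
have cv i := continuous_cert_val (c := c) (i := i) cq.
have hp' : \forall u \near x,
    all (fun i => (i \in t) || (0 < cert_val (coords (q u)) c i)) s.
  apply: near_all hp => i; case: (i \in t) => [_|/= h]; first exact: nearW.
  exact: (cvgr_gt _ (cv i)).
have hn' : \forall u \near x,
    all (fun i => (i \in s) || (cert_val (coords (q u)) c i < 0)) t.
  apply: near_all hn => i; case: (i \in s) => [_|/= h]; first exact: nearW.
  exact: (cvgr_lt _ (cv i)).
by apply: filterS2 hp' hn' => u hpu hnu; apply/and3P; split.
Qed.

(** * The tented bipyramid as an abstract complex *)

(** Sorted and free of repetitions, this is a normal form that decides equality of faces. *)
Definition code n (s : seq nat) : seq nat := [seq k <- iota 0 n | k \in s].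

Lemma eq_face n s t : (face n s == face n t) = (code n s == code n t).
Proof.
apply/eqP/eqP => [e|e]; first by rewrite /code -!enum_face e.
apply/setP => i; rewrite !inE.
have := congr1 (fun l => (i : nat) \in l) e.
by rewrite !mem_filter mem_iota add0n ltn_ord !andbT.
Qed.

Lemma face3 n (i j k : 'I_n) : [set i; j; k]%SET = face n [:: val i; val j; val k].
Proof. by apply/setP => l; rewrite !inE -!val_eqE orbA. Qed.

Lemma tent_complex n fs s (T : 'I_n) : all (fun i : nat => (i < n)%N) s ->
  tent (complex n fs) (face n s) T =
  complex n ([seq t <- fs | code n t != code n s] ++
             [seq val T :: [seq j <- s | j != i] | i <- s]).
Proof.
move=> /allP sn; apply/setP => G; rewrite /tent finset.in_setU finset.in_setD1.
have faceT i : (i : 'I_n) \in face n s ->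
    (T |: face n s :\ i)%SET = face n (val T :: [seq j <- s | j != val i]).
  by move=> _; apply/setP => j; rewrite !inE mem_filter.
apply/orP/complexP.
  case=> [/andP[Gs /complexP[t tfs Gt]]|/imsetP[i si ->]].
    exists t => //; rewrite mem_cat mem_filter tfs andbT -eq_face -Gt.
    by rewrite Gs.
  exists (val T :: [seq j <- s | j != val i]); last by rewrite faceT.
  rewrite mem_cat; apply/orP; right; rewrite inE in si.
  exact: (map_f (fun i => val T :: [seq j <- s | j != i])).
case=> t; rewrite mem_cat mem_filter => /orP[/andP[ts tfs] ->|/mapP[i si ->] ->].
  by left; rewrite eq_face ts face_complex.
right; apply/imsetP; exists (Ordinal (sn i si)); first by rewrite inE.
by rewrite faceT// inE.
Qed.

Lemma cover_complex n fs : all (fun i => has (fun s => i \in s) fs) (iota 0 n) ->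
  finset.cover (complex n fs) = [set: 'I_n]%SET.
Proof.
move=> /allP h; apply/setP => i; rewrite finset.in_setT; apply/finset.bigcupP.
have /hasP[s sfs si] := h i ltac:(by rewrite mem_iota ltn_ord).
by exists (face n s); [exact: face_complex | rewrite inE].
Qed.

(** * Integer test for convex polytopes *)

Section PolytopeCheck.
Variable V : nat -> nat -> Z.

Let dot3 (u v : nat -> Z) := u 0%N * v 0%N + u 1%N * v 1%N + u 2%N * v 2%N.

Definition facet_normal (l : seq nat) (j : nat) : Z :=
  let a := V (nth 0%N l 0) in
  let b k := V (nth 0%N l 1) k - a k in
  let c k := V (nth 0%N l 2) k - a k in
  match j with
  | 0 => b 1%N * c 2%N - b 2%N * c 1%N
  | 1 => b 2%N * c 0%N - b 0%N * c 2%N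
  | _ => b 0%N * c 1%N - b 1%N * c 0%N
  end.

Definition facet_level (l : seq nat) : Z :=
  dot3 (V (nth 0%N l 0)) (facet_normal l).

(** The cross product [facet_normal] may point inwards. Multiplying the inequality by [facet_level]
    makes the test independent of this orientation; dividing the normal by the level gives the [nu]
    of the polytope criterion. *)
Definition polytope_check n (fs : seq (seq nat)) : bool :=
  all (fun s => let l := code n s in
    [&& size l == 3%N, facet_level l != 0 &
     all (fun i => let x := dot3 (V i) (facet_normal l) in
       if i \in s then x == facet_level l
       else x * facet_level l < facet_level l * facet_level l) (iota 0 n)]) fs.

Lemma polytope_sphere (R : realType) n fs : fs != [::] -> edge_adjacent fs ->
  polytope_check n fs -> triangulated_sphere R (complex n fs).
Proof.
move=> fs0 adj /allP chk.
pose W (i : 'I_n) : E3 R := \row_j Zto R (V i j).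
pose nu (F : {set 'I_n}) : E3 R := let l := map (@nat_of_ord n) (enum F) in
  \row_j (Zto R (facet_normal l j) / Zto R (facet_level l)).
have dotW (i : 'I_n) s : dot (W i) (nu (face n s)) =
    Zto R (dot3 (V i) (facet_normal (code n s))) / Zto R (facet_level (code n s)).
  rewrite dot_inord !mxE !inordK// enum_face /dot3.
  move: (facet_level _) (facet_normal _) => d v.
  by rewrite !(rmorphD, rmorphM) !mulrDl !mulrA.
have Zto_eq0 z : (Zto R z == 0) = (z == 0).
  by have := Zto_gt0 R z; have := Zto_lt0 R z; case: ltrgt0P => //; lia.
apply: (convex_polytope_sphere (V := W) (nu := nu)).
- case: fs fs0 {adj chk} => // s fs _; exists (face n s).
  by apply: face_complex; rewrite mem_head.
- move=> _ /complexP[s sfs ->]; have /and3P[/eqP l3 _ _] := chk s sfs.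
  by rewrite card_face -size_filter.
- move=> _ i /complexP[s sfs ->]; rewrite inE => si.
  have /and3P[_ d0 /allP/(_ i)] := chk s sfs.
  rewrite mem_iota ltn_ord si => /(_ isT)/eqP x.
  by rewrite dotW x divff// Zto_eq0.
- move=> _ i /complexP[s sfs ->]; rewrite inE => /negbTE si.
  have /and3P[_ d0 /allP/(_ i)] := chk s sfs.
  rewrite mem_iota ltn_ord si => /(_ isT) x.
  rewrite dotW -subr_gt0; set d := facet_level _ in d0 x *.
  set y := dot3 _ _ in x *.
  have d0' : Zto R d != 0 by rewrite Zto_eq0.
  have -> : 1 - Zto R y / Zto R d = Zto R (d * d - y * d) / (Zto R d) ^+ 2.
    by rewrite rmorphB !rmorphM /=; field.
  by rewrite divr_gt0// ?exprn_even_gt0//= Zto_gt0 subr_gt0.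
- exact: edge_adjacentP.
Qed.

End PolytopeCheck.

(** The numbers 0 to 7 stand for A, B, A', B', C, C'', D, T. *)
Definition bipyramid_faces : seq (seq nat) :=
  [:: [:: 0; 1; 4]; [:: 4; 1; 2]; [:: 2; 1; 5]; [:: 5; 1; 6]; [:: 6; 1; 0];
      [:: 0; 3; 4]; [:: 4; 3; 2]; [:: 2; 3; 5]; [:: 5; 3; 6]; [:: 6; 3; 0]]%N.

Definition tent_faces : seq (seq nat) :=
  [:: [:: 0; 1; 4]; [:: 2; 1; 5]; [:: 5; 1; 6]; [:: 6; 1; 0];
      [:: 0; 3; 4]; [:: 4; 3; 2]; [:: 2; 3; 5]; [:: 5; 3; 6]; [:: 6; 3; 0];
      [:: 7; 1; 2]; [:: 7; 4; 2]; [:: 7; 4; 1]]%N.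

Lemma bipyramidE : bipyramid = complex 8 bipyramid_faces.
Proof. by rewrite /bipyramid !face3. Qed.

Lemma tent_bipyramidE :
  tent bipyramid [set vC; vB; vA']%SET vT = complex 8 tent_faces.
Proof. by rewrite bipyramidE face3 tent_complex. Qed.

Lemma tent_faces_adjacent : edge_adjacent tent_faces.
Proof. by vm_compute. Qed.

(* The vertices, in the order of Defs, of a convex polytope whose boundary has
   the combinatorics of [tent_faces]. *)
Definition convex_model : seq (seq Z) :=
  [:: [:: 4; -2; 0]; [:: 0; 0; 2]; [:: -2; 4; 0]; [:: 0; 0; -2];
      [:: 2; 4; 0]; [:: -4; -2; 0]; [:: 0; -4; 0]; [:: 0; 3; 1]].

Lemma tent_faces_sphere (R : realType) :
  triangulated_sphere R (complex 8 tent_faces).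
Proof.
by apply: (@polytope_sphere (fun i j => nth 0 (nth [::] convex_model i) j)); vm_compute.
Qed.

Definition tent_vertices : seq (seq Z) :=
  [:: [:: -5; 15; 0]; [:: 25; 0; -20]; [:: 5; -15; 0]; [:: -25; 0; -20];
      [:: -25; 30; 15]; [:: 25; 3; 26]; [:: 5; 0; 5]; [:: 50; -3; 54]].

(** One certificate for each of the 66 pairs of faces: [Hinge] for the 18 pairs sharing an edge,
    [Flat] for the others, with offset 0 if they share a vertex. *)
Definition tent_certificates : seq (seq nat * seq nat * certificate) :=
  [:: ([:: 0; 1; 4]%N, [:: 2; 1; 5]%N, Flat 1 [:: -1; 1; -1] 0);
   ([:: 0; 1; 4]%N, [:: 5; 1; 6]%N, Flat 1 [:: -1; 1; -1] 0);
   ([:: 0; 1; 4]%N, [:: 6; 1; 0]%N, Hinge 0 1 [:: 0; 0; 1]);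
   ([:: 0; 1; 4]%N, [:: 0; 3; 4]%N, Hinge 0 4 [:: 0; 0; -1]);
   ([:: 0; 1; 4]%N, [:: 4; 3; 2]%N, Flat 4 [:: 1; 1; 0] 0);
   ([:: 0; 1; 4]%N, [:: 2; 3; 5]%N, Flat 0 [:: 1; 2; -1] 13);
   ([:: 0; 1; 4]%N, [:: 5; 3; 6]%N, Flat 0 [:: 1; 2; -1] 13);
   ([:: 0; 1; 4]%N, [:: 6; 3; 0]%N, Flat 0 [:: 2; 3; 0] 0);
   ([:: 0; 1; 4]%N, [:: 7; 1; 2]%N, Flat 1 [:: 0; 1; 0] 0);
   ([:: 0; 1; 4]%N, [:: 7; 4; 2]%N, Flat 4 [:: 1; 2; -1] 0);
   ([:: 0; 1; 4]%N, [:: 7; 4; 1]%N, Hinge 1 4 [:: 0; -1; 0]);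
   ([:: 2; 1; 5]%N, [:: 5; 1; 6]%N, Hinge 1 5 [:: 1; 0; -2]);
   ([:: 2; 1; 5]%N, [:: 6; 1; 0]%N, Flat 1 [:: 2; -2; 1] 0);
   ([:: 2; 1; 5]%N, [:: 0; 3; 4]%N, Flat 2 [:: 1; -1; 0] 20);
   ([:: 2; 1; 5]%N, [:: 4; 3; 2]%N, Flat 2 [:: 1; 0; 0] 0);
   ([:: 2; 1; 5]%N, [:: 2; 3; 5]%N, Hinge 2 5 [:: 0; 0; -1]);
   ([:: 2; 1; 5]%N, [:: 5; 3; 6]%N, Flat 5 [:: 1; -2; 0] 0);
   ([:: 2; 1; 5]%N, [:: 6; 3; 0]%N, Flat 2 [:: 1; -1; 0] 8);
   ([:: 2; 1; 5]%N, [:: 7; 1; 2]%N, Hinge 2 1 [:: 0; 0; 1]);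
   ([:: 2; 1; 5]%N, [:: 7; 4; 2]%N, Flat 2 [:: 2; 1; -2] 0);
   ([:: 2; 1; 5]%N, [:: 7; 4; 1]%N, Flat 1 [:: -4; -8; 1] 0);
   ([:: 5; 1; 6]%N, [:: 6; 1; 0]%N, Hinge 1 6 [:: 0; 1; 0]);
   ([:: 5; 1; 6]%N, [:: 0; 3; 4]%N, Flat 5 [:: 1; -1; 0] 30);
   ([:: 5; 1; 6]%N, [:: 4; 3; 2]%N, Flat 5 [:: 2; 1; 0] 51);
   ([:: 5; 1; 6]%N, [:: 2; 3; 5]%N, Flat 5 [:: 9; 5; -10] 0);
   ([:: 5; 1; 6]%N, [:: 5; 3; 6]%N, Hinge 5 6 [:: 0; -1; 0]);
   ([:: 5; 1; 6]%N, [:: 6; 3; 0]%N, Flat 6 [:: 1; 0; 0] 0);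
   ([:: 5; 1; 6]%N, [:: 7; 1; 2]%N, Flat 1 [:: -1; 2; 0] 0);
   ([:: 5; 1; 6]%N, [:: 7; 4; 2]%N, Flat 5 [:: 1; 1; -1] 6);
   ([:: 5; 1; 6]%N, [:: 7; 4; 1]%N, Flat 1 [:: -4; -8; 1] 0);
   ([:: 6; 1; 0]%N, [:: 0; 3; 4]%N, Flat 0 [:: 1; 0; 0] 0);
   ([:: 6; 1; 0]%N, [:: 4; 3; 2]%N, Flat 6 [:: 2; 1; 0] 10);
   ([:: 6; 1; 0]%N, [:: 2; 3; 5]%N, Flat 6 [:: 6; 3; -7] 3);
   ([:: 6; 1; 0]%N, [:: 5; 3; 6]%N, Flat 6 [:: 6; 2; -7] 0);
   ([:: 6; 1; 0]%N, [:: 6; 3; 0]%N, Hinge 6 0 [:: 0; 0; -1]);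
   ([:: 6; 1; 0]%N, [:: 7; 1; 2]%N, Flat 1 [:: -1; 2; 0] 0);
   ([:: 6; 1; 0]%N, [:: 7; 4; 2]%N, Flat 6 [:: 1; 1; -1] 4);
   ([:: 6; 1; 0]%N, [:: 7; 4; 1]%N, Flat 1 [:: -4; -7; 0] 0);
   ([:: 0; 3; 4]%N, [:: 4; 3; 2]%N, Hinge 3 4 [:: -1; 0; -1]);
   ([:: 0; 3; 4]%N, [:: 2; 3; 5]%N, Flat 3 [:: -1; 2; 0] 0);
   ([:: 0; 3; 4]%N, [:: 5; 3; 6]%N, Flat 3 [:: -1; 2; 0] 0);
   ([:: 0; 3; 4]%N, [:: 6; 3; 0]%N, Hinge 0 3 [:: 0; 0; -1]);
   ([:: 0; 3; 4]%N, [:: 7; 1; 2]%N, Flat 0 [:: -1; 1; 0] 20);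
   ([:: 0; 3; 4]%N, [:: 7; 4; 2]%N, Flat 4 [:: 0; 1; -2] 0);
   ([:: 0; 3; 4]%N, [:: 7; 4; 1]%N, Flat 4 [:: -2; -3; 0] 0);
   ([:: 4; 3; 2]%N, [:: 2; 3; 5]%N, Hinge 3 2 [:: -1; 0; -1]);
   ([:: 4; 3; 2]%N, [:: 5; 3; 6]%N, Flat 3 [:: -1; -1; 1] 0);
   ([:: 4; 3; 2]%N, [:: 6; 3; 0]%N, Flat 3 [:: -1; -1; 1] 0);
   ([:: 4; 3; 2]%N, [:: 7; 1; 2]%N, Flat 2 [:: -1; 0; 0] 0);
   ([:: 4; 3; 2]%N, [:: 7; 4; 2]%N, Hinge 4 2 [:: 0; 0; -1]);
   ([:: 4; 3; 2]%N, [:: 7; 4; 1]%N, Flat 4 [:: -1; -1; 0] 0);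
   ([:: 2; 3; 5]%N, [:: 5; 3; 6]%N, Hinge 3 5 [:: 0; -1; -1]);
   ([:: 2; 3; 5]%N, [:: 6; 3; 0]%N, Flat 3 [:: -6; -3; 7] 0);
   ([:: 2; 3; 5]%N, [:: 7; 1; 2]%N, Flat 2 [:: -2; 2; 1] 0);
   ([:: 2; 3; 5]%N, [:: 7; 4; 2]%N, Flat 2 [:: 3; 3; -4] 0);
   ([:: 2; 3; 5]%N, [:: 7; 4; 1]%N, Flat 2 [:: -3; -6; 1] 148);
   ([:: 5; 3; 6]%N, [:: 6; 3; 0]%N, Hinge 3 6 [:: 0; -1; -1]);
   ([:: 5; 3; 6]%N, [:: 7; 1; 2]%N, Flat 5 [:: -1; 2; 0] 3);
   ([:: 5; 3; 6]%N, [:: 7; 4; 2]%N, Flat 5 [:: 1; 1; -1] 8);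
   ([:: 5; 3; 6]%N, [:: 7; 4; 1]%N, Flat 5 [:: -3; -6; 1] 6);
   ([:: 6; 3; 0]%N, [:: 7; 1; 2]%N, Flat 6 [:: -1; 1; 0] 8);
   ([:: 6; 3; 0]%N, [:: 7; 4; 2]%N, Flat 6 [:: 1; 1; -1] 6);
   ([:: 6; 3; 0]%N, [:: 7; 4; 1]%N, Flat 6 [:: -2; -3; 0] 28);
   ([:: 7; 1; 2]%N, [:: 7; 4; 2]%N, Hinge 7 2 [:: 0; -1; 0]);
   ([:: 7; 1; 2]%N, [:: 7; 4; 1]%N, Hinge 7 1 [:: -1; 0; 0]);
   ([:: 7; 4; 2]%N, [:: 7; 4; 1]%N, Hinge 7 4 [:: 0; 1; 1])].

Lemma tent_pairs_certified : all_pairs_certified tent_faces tent_certificates.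
Proof. by vm_compute. Qed.

(* Out-of-range indices are sent to 0, as [inord] does. *)
Definition tent_coord (i j : nat) : Z :=
  nth 0 (nth [::] tent_vertices (if (i < 8)%N then i else 0%N))
    (if (j < 3)%N then j else 0%N).

Lemma tent_certificates_check (R : realType) :
  all (cert_check (fun i j => Zto R (tent_coord i j))) tent_certificates.
Proof.
suff : all (cert_check tent_coord) tent_certificates.
  by apply: sub_all => x; exact: cert_check_Zto.
by vm_compute.
Qed.

(** * Half-turn symmetric configurations *)

Section Points.
Variable R : realType.
Implicit Types (m u v x y : E3 R).

Definition pt (a b c : R) : E3 R := \row_j nth 0 [:: a; b; c] j.

Lemma ptE (a b c : R) : pt a b c = a *: pt 1 0 0 + b *: pt 0 1 0 + c *: pt 0 0 1.
Proof.
by apply/rowP => -[[|[|[|//]]] i3]; rewrite !mxE/=; ring.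
Qed.

Lemma eq_pt (a b c a' b' c' : R) : a = a' -> b = b' -> c = c' -> pt a b c = pt a' b' c'.
Proof. by move=> -> -> ->. Qed.

Lemma ptD (a b c a' b' c' : R) : pt a b c + pt a' b' c' = pt (a + a') (b + b') (c + c').
Proof. by apply/rowP => -[[|[|[|//]]] i3]; rewrite !mxE. Qed.

Lemma ptN a b c : - pt a b c = pt (- a) (- b) (- c).
Proof. by apply/rowP => -[[|[|[|//]]] i3]; rewrite !mxE. Qed.

Lemma ptB (a b c a' b' c' : R) : pt a b c - pt a' b' c' = pt (a - a') (b - b') (c - c').
Proof. by rewrite ptN ptD. Qed.

Lemma ptZ l a b c : l *: pt a b c = pt (l * a) (l * b) (l * c).
Proof. by apply/rowP => -[[|[|[|//]]] i3]; rewrite !mxE. Qed.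

Lemma dot_pt (a b c a' b' c' : R) :
  dot (pt a b c) (pt a' b' c') = a * a' + b * b' + c * c'.
Proof. by rewrite dot_inord !mxE !inordK. Qed.

Lemma pt_inj (a b c a' b' c' : R) :
  pt a b c = pt a' b' c' -> [/\ a = a', b = b' & c = c'].
Proof.
move=> /rowP e; have := e (inord 0); have := e (inord 1); have := e (inord 2).
by rewrite !mxE !inordK.
Qed.

Definition dist2 x y : R := dot (x - y) (x - y).

Lemma dist2C x y : dist2 x y = dist2 y x.
Proof. by rewrite /dist2 -opprB dotNl dotNr opprK. Qed.

Lemma dist2_pt (a b c a' b' c' : R) : dist2 (pt a b c) (pt a' b' c') =
  (a - a') ^+ 2 + (b - b') ^+ 2 + (c - c') ^+ 2.
Proof. by rewrite /dist2 ptB dot_pt !expr2. Qed.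

Lemma eucl_distE x y : eucl_dist x y = Num.sqrt (dist2 x y).
Proof. by []. Qed.

Lemma dist2_reflection (a : E3 R) m x y : m != 0 ->
  dist2 (reflection a m x) (reflection a m y) = dist2 x y.
Proof.
rewrite -dot_eq0 => m0; rewrite /dist2.
have -> : reflection a m x - reflection a m y =
    (x - y) - (2 * (dot (x - y) m / dot m m)) *: m.
  have -> : dot (x - y) m = dot (x - a) m - dot (y - a) m.
    by rewrite !dotBl; ring.
  by apply/rowP => i; rewrite !mxE; field.
move: (x - y) => z; rewrite !dotBl !dotBr !dotZl !dotZr (dotC m z).
by field.
Qed.

Lemma reflection_fix (a : E3 R) m x : dot (x - a) m = 0 -> reflection a m x = x.
Proof. by move=> e; rewrite /reflection e mul0r mulr0 scale0r subr0. Qed.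

Lemma reflectionK (a : E3 R) m x : m != 0 -> reflection a m (reflection a m x) = x.
Proof.
rewrite -dot_eq0 => m0; rewrite /reflection.
have -> : dot (x - (2 * (dot (x - a) m / dot m m)) *: m - a) m = - dot (x - a) m.
  by rewrite !dotBl dotZl; field.
by apply/rowP => i; rewrite !mxE; field.
Qed.

Lemma continuous_pt (T : topologicalType) (f g h : T -> R) (t : T) :
  {for t, continuous f} -> {for t, continuous g} -> {for t, continuous h} ->
  {for t, continuous (fun s => pt (f s) (g s) (h s))}.
Proof.
move=> cf cg ch; have -> : (fun s => pt (f s) (g s) (h s)) =
    (fun s => f s *: pt 1 0 0 + g s *: pt 0 1 0 + h s *: pt 0 0 1).
  by apply/funext => s; rewrite [LHS]ptE.
by apply: (@continuousD _ (E3 R)); [apply: (@continuousD _ (E3 R))|];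
  apply: continuousZr_tmp.
Qed.

End Points.

Section RealContinuity.
Variables (R : realType) (T : topologicalType) (f g : T -> R) (t : T).
Hypotheses (cf : {for t, continuous f}) (cg : {for t, continuous g}).

Lemma cont_cst (a : R) : {for t, continuous (fun=> a)}.
Proof. exact: cst_continuous. Qed.

Lemma cont_add : {for t, continuous (fun s => f s + g s)}.
Proof. exact: (@continuousD R R^o). Qed.

Lemma cont_opp : {for t, continuous (fun s => - f s)}.
Proof. exact: (@continuousN R R^o). Qed.

Lemma cont_mul : {for t, continuous (fun s => f s * g s)}.
Proof. exact: continuousM. Qed.

Lemma cont_sqr : {for t, continuous (fun s => f s ^+ 2)}.
Proof. exact: (@continuousM _ _ f f). Qed.

Lemma cont_inv : f t != 0 -> {for t, continuous (fun s => (f s)^-1)}.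
Proof. by move=> ft0; apply: continuousV. Qed.

Lemma cont_sqrt : {for t, continuous (fun s => Num.sqrt (f s))}.
Proof. exact: (continuous_comp cf (@sqrt_continuous R _)). Qed.

End RealContinuity.

(** * Coordinates of the points and their distances *)

Record params (R : realType) :=
  Params { px : R; py : R; pp : R; pq : R; ph : R; pk : R }.

Section Configuration.
Variable R : realType.
Implicit Type c : params R.

(** The half-turn is about the third axis. A translation along it puts A at height 0, a rotation
    about it puts B over the first axis. The first coordinate of C is 5y because a . b and b . c
    stay constant with ratio 5. *)
Definition posA c := pt (py c) (pp c) 0.
Definition posA' c := pt (- py c) (- pp c) 0.
Definition posB c := pt (px c) 0 (ph c).
Definition posB' c := pt (- px c) 0 (ph c).
Definition posC c := pt (5 * py c) (pq c) (pk c).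
Definition posC' c := pt (- (5 * py c)) (- pq c) (pk c).
(** This is A + (C' - A) / 3. Its first coordinate agrees with that of A', so D - A' is orthogonal
    to BB'. *)
Definition posD c := pt (- py c) ((2 * pp c - pq c) / 3) (pk c / 3).
(** This vector is 3 (D - A'), a normal of the plane that is to swap D and A'. *)
Definition mirror c := pt 0 (5 * pp c - pq c) (pk c).
Definition posC'' c := reflection (posB c) (mirror c) (posC' c).
(** This is A' minus 1/25 of the cross product of C - A' and B - A', so T moves rigidly with the
    face CBA'. *)
Definition posT c :=
  pt (- py c - ((pq c + pp c) * ph c - pk c * pp c) / 25)
     (- pp c - (pk c * (px c + py c) - 6 * py c * ph c) / 25)
     (- (6 * py c * pp c - (pq c + pp c) * (px c + py c)) / 25).

Definition pos c : 'I_8 -> E3 R :=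
  positions (posA c) (posB c) (posA' c) (posB' c) (posC c) (posC'' c) (posD c) (posT c).

(* Apart from [pk c != 0], equivalent to the edge lengths of the octahedron
   being those at the start: they fix [a . b], [b . c], [a . c] and [|a|^2 + |b|^2 + (a_3 - b_3)^2], etc.,
   for the horizontal parts a, b, c of A, B, C. *)
Definition admissible c : Prop :=
  [/\ px c * py c = -125,
      px c ^+ 2 + py c ^+ 2 + pp c ^+ 2 + ph c ^+ 2 = 1275,
      px c ^+ 2 + 25 * py c ^+ 2 + pq c ^+ 2 + (ph c - pk c) ^+ 2 = 3375,
      26 * py c ^+ 2 + pp c ^+ 2 + pq c ^+ 2 + pk c ^+ 2 = 2000 &
      5 * py c ^+ 2 + pp c * pq c = 575 /\ pk c != 0].

Lemma mirror_neq0 c : admissible c -> mirror c != 0.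
Proof.
move=> [_ _ _ _ [_ k0]]; apply: contra_neq k0 => /rowP/(_ (inord 2)).
by rewrite !mxE inordK.
Qed.

Lemma mirrorB' c : reflection (posB c) (mirror c) (posB' c) = posB' c.
Proof. by apply: reflection_fix; rewrite ptB dot_pt; ring. Qed.

Lemma mirrorB c : reflection (posB c) (mirror c) (posB c) = posB c.
Proof. by apply: reflection_fix; rewrite subrr dot0l. Qed.

Lemma mirrorD c : admissible c -> reflection (posB c) (mirror c) (posD c) = posA' c.
Proof.
move=> ac; have := mirror_neq0 ac; rewrite -dot_eq0; case: ac => h1 h2 h3 h4 [h5 k0].
move=> m0.
(* As [mirror c] is 3 (D - A'), this identity says that D and A' are equidistant from B. *)
have e : 6 * dot (posD c - posB c) (mirror c) = dot (mirror c) (mirror c).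
  by rewrite ptB !dot_pt; lra.
have -> : reflection (posB c) (mirror c) (posD c) = posD c - 3^-1 *: mirror c.
  rewrite /reflection -e; congr (_ - _ *: _).
  by move: m0; rewrite -e mulf_eq0 negb_or => /andP[_ d0]; field.
by rewrite ptZ ptB; apply: eq_pt; field.
Qed.

Lemma mirrorA' c : admissible c -> reflection (posB c) (mirror c) (posA' c) = posD c.
Proof. by move=> ac; rewrite -[in LHS]mirrorD// reflectionK// mirror_neq0. Qed.

(** The reflection fixes B and B' and swaps D with A', so lengths at C'', and those from B and B' to
    D, reduce to lengths before reflecting; all of these are linear combinations of the relations in
    [admissible]. *)
Lemma dist2_edges c : admissible c ->
  (((dist2 (posA c) (posB c) = 1525) * (dist2 (posA c) (posB' c) = 1025)) *
   ((dist2 (posB c) (posA' c) = 1025) * (dist2 (posB' c) (posA' c) = 1525)) *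
   ((dist2 (posA c) (posC c) = 850) * (dist2 (posC c) (posA' c) = 3150)) *
   ((dist2 (posB c) (posC c) = 4625) * (dist2 (posB' c) (posC c) = 2125)) *
   ((dist2 (posB c) (posD c) = 1025) * (dist2 (posB' c) (posD c) = 1525)) *
   ((dist2 (posA c) (posD c) = 350)) *
   ((dist2 (posC'' c) (posA' c) = 1400) * (dist2 (posC'' c) (posD c) = 850)) *
   ((dist2 (posB c) (posC'' c) = 2125) * (dist2 (posB' c) (posC'' c) = 4625)))%type.
Proof.
move=> ac; have m0 := mirror_neq0 ac; have rD := mirrorD ac; have rA := mirrorA' ac.
have m_isom x y := dist2_reflection (posB c) x y m0.
have bd : dist2 (posB c) (posD c) = dist2 (posB c) (posA' c).
  by rewrite -(m_isom (posB c) (posA' c)) mirrorB rA.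
have b'd : dist2 (posB' c) (posD c) = dist2 (posB' c) (posA' c).
  by rewrite -(m_isom (posB' c) (posA' c)) mirrorB' rA.
have c''a' : dist2 (posC'' c) (posA' c) = dist2 (posC' c) (posD c).
  by rewrite -(m_isom (posC' c) (posD c)) rD.
have c''d : dist2 (posC'' c) (posD c) = dist2 (posC' c) (posA' c).
  by rewrite -(m_isom (posC' c) (posA' c)) rA.
have bc'' : dist2 (posB c) (posC'' c) = dist2 (posB c) (posC' c).
  by rewrite -(m_isom (posB c) (posC' c)) mirrorB.
have b'c'' : dist2 (posB' c) (posC'' c) = dist2 (posB' c) (posC' c).
  by rewrite -(m_isom (posB' c) (posC' c)) mirrorB'.
rewrite bd b'd c''a' c''d bc'' b'c'' !dist2_pt {bd b'd c''a' c''d bc'' b'c'' rD rA m0}.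
case: ac => h1 h2 h3 h4 [h5 _].
by do ![split]; lra.
Qed.

(** With u = C - A' and v = B - A', Lagrange's identity |u x v|^2 = |u|^2 |v|^2 - (u . v)^2 gives
    TA'. As TA' is orthogonal to the face, Pythagoras gives TB and TC. *)
Lemma dist2_tent c : admissible c ->
  [/\ dist2 (posT c) (posA' c) = 5085, dist2 (posT c) (posB c) = 6110 &
      dist2 (posT c) (posC c) = 8235].
Proof.
move=> ac; have := dist2_edges ac.
move=> [[[[[[[_ [vv _]] [_ uu]] [uw _]] _] _] _] _].
pose U := (6 * py c) ^+ 2 + (pq c + pp c) ^+ 2 + pk c ^+ 2.
pose V := (px c + py c) ^+ 2 + pp c ^+ 2 + ph c ^+ 2.
pose W := 6 * py c * (px c + py c) + (pq c + pp c) * pp c + pk c * ph c.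
rewrite !dist2_pt in vv uu uw.
have eU : U = 3150 by rewrite -uu /U; ring.
have eV : V = 1025 by rewrite -vv /V; ring.
have eW : W = -225 by move: uu vv uw; rewrite /W; lra.
have eN : dist2 (posT c) (posA' c) = (U * V - W ^+ 2) / 625.
  by rewrite dist2_pt /U /V /W; field.
have -> : dist2 (posT c) (posB c) = (U * V - W ^+ 2) / 625 + V.
  by rewrite dist2_pt /U /V /W; field.
have -> : dist2 (posT c) (posC c) = (U * V - W ^+ 2) / 625 + U.
  by rewrite dist2_pt /U /V /W; field.
by rewrite eN eU eV eW; split; lra.
Qed.

Lemma continuous_pos (T : topologicalType) (f : T -> params R) (t : T) (i : 'I_8) :
  {for t, continuous (fun s => px (f s))} ->
  {for t, continuous (fun s => py (f s))} ->
  {for t, continuous (fun s => pp (f s))} ->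
  {for t, continuous (fun s => pq (f s))} ->
  {for t, continuous (fun s => ph (f s))} ->
  {for t, continuous (fun s => pk (f s))} ->
  admissible (f t) -> {for t, continuous (fun s => pos (f s) i)}.
Proof.
move=> cx cy cp cq ch ck ac.
have c1 a : {for t, continuous (fun=> a : R)} by exact: cont_cst.
have cA : {for t, continuous (fun s => posA (f s))}.
  exact: (continuous_pt cy cp (c1 0)).
have cA' : {for t, continuous (fun s => posA' (f s))}.
  exact: (continuous_pt (cont_opp cy) (cont_opp cp) (c1 0)).
have cB : {for t, continuous (fun s => posB (f s))}.
  exact: (continuous_pt cx (c1 0) ch).
have cB' : {for t, continuous (fun s => posB' (f s))}.
  exact: (continuous_pt (cont_opp cx) (c1 0) ch).
have cC : {for t, continuous (fun s => posC (f s))}.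
  exact: (continuous_pt (cont_mul (c1 5) cy) cq ck).
have cC' : {for t, continuous (fun s => posC' (f s))}.
  exact: (continuous_pt (cont_opp (cont_mul (c1 5) cy)) (cont_opp cq) ck).
have cD : {for t, continuous (fun s => posD (f s))}.
  exact: (continuous_pt (cont_opp cy)
    (cont_mul (cont_add (cont_mul (c1 2) cp) (cont_opp cq)) (c1 3^-1))
    (cont_mul ck (c1 3^-1))).
have cm : {for t, continuous (fun s => mirror (f s))}.
  exact: (continuous_pt (c1 0) (cont_add (cont_mul (c1 5) cp) (cont_opp cq)) ck).
have c6y := (cont_mul (c1 6) cy).
have cqp := (cont_add cq cp).
have cxy := (cont_add cx cy).
have cT : {for t, continuous (fun s => posT (f s))}.
  exact: (continuous_pt
    (cont_add (cont_opp cy) (cont_opp (cont_mul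
      (cont_add (cont_mul cqp ch) (cont_opp (cont_mul ck cp))) (c1 25^-1))))
    (cont_add (cont_opp cp) (cont_opp (cont_mul
      (cont_add (cont_mul ck cxy) (cont_opp (cont_mul c6y ch))) (c1 25^-1))))
    (cont_mul (cont_opp (cont_add (cont_mul c6y cp) (cont_opp (cont_mul cqp cxy))))
      (c1 25^-1))).
have cC'' : {for t, continuous (fun s => posC'' (f s))}.
  have m0 : dot (mirror (f t)) (mirror (f t)) != 0 by rewrite dot_eq0 mirror_neq0.
  have cd := continuous_dot (@continuousB _ (E3 R) _ _ _ _ cC' cB) cm.
  have cmm := cont_inv (continuous_dot cm cm) m0.
  exact: (@continuousB _ (E3 R) _ _ _ _ cC'
    (continuousZ (cont_mul (c1 2) (cont_mul cd cmm)) cm)).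
case: i => -[|[|[|[|[|[|[|[|k]]]]]]]] i8.
- exact: cA.
- exact: cB.
- exact: cA'.
- exact: cB'.
- exact: cC.
- exact: cC''.
- exact: cD.
- exact: cT.
- by [].
Qed.

Definition same_dist (i j : 'I_8) : Prop := forall c c',
  admissible c -> admissible c' ->
  eucl_dist (pos c i) (pos c j) = eucl_dist (pos c' i) (pos c' j).

Lemma same_distC i j : same_dist i j -> same_dist j i.
Proof.
by move=> ij c c' ac ac'; have := ij c c' ac ac';
  rewrite !eucl_distE !(dist2C (pos _ j)).
Qed.

Lemma same_dist_const i j a :
  (forall c, admissible c -> dist2 (pos c i) (pos c j) = a) -> same_dist i j.
Proof. by move=> h c c' ac ac'; rewrite !eucl_distE !h. Qed.

Lemma same_dist_face i j k l m : same_dist i j -> same_dist j k -> same_dist i k ->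
  l \in face 8 [:: val i; val j; val k] -> m \in face 8 [:: val i; val j; val k] ->
  same_dist l m.
Proof.
have refl n : same_dist n n by move=> c c' _ _; rewrite !eucl_distE /dist2 !subrr.
move=> ij jk ik; rewrite -face3 !inE.
move=> /orP[/orP[]|] /eqP-> /orP[/orP[]|] /eqP->.
all: by [exact: refl | | apply: same_distC].
Qed.

Lemma same_dist_edge i j : edge (complex 8 tent_faces) i j -> same_dist i j.
Proof.
move=> [_ [F /complexP[s sF ->] /andP[]]].
have dAB : same_dist vA vB by apply: same_dist_const => c ac; rewrite dist2_edges.
have dAB' : same_dist vA vB' by apply: same_dist_const => c ac; rewrite dist2_edges.
have dBA' : same_dist vB vA' by apply: same_dist_const => c ac; rewrite dist2_edges.
have dB'A' : same_dist vB' vA' by apply: same_dist_const => c ac; rewrite dist2_edges.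
have dAC : same_dist vA vC by apply: same_dist_const => c ac; rewrite dist2_edges.
have dCA' : same_dist vC vA' by apply: same_dist_const => c ac; rewrite dist2_edges.
have dBC : same_dist vB vC by apply: same_dist_const => c ac; rewrite dist2_edges.
have dB'C : same_dist vB' vC by apply: same_dist_const => c ac; rewrite dist2_edges.
have dBD : same_dist vB vD by apply: same_dist_const => c ac; rewrite dist2_edges.
have dB'D : same_dist vB' vD by apply: same_dist_const => c ac; rewrite dist2_edges.
have dAD : same_dist vA vD by apply: same_dist_const => c ac; rewrite dist2_edges.
have dC''A' : same_dist vC'' vA' by apply: same_dist_const => c ac; rewrite dist2_edges.
have dC''D : same_dist vC'' vD by apply: same_dist_const => c ac; rewrite dist2_edges.
have dBC'' : same_dist vB vC'' by apply: same_dist_const => c ac; rewrite dist2_edges.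
have dB'C'' : same_dist vB' vC'' by apply: same_dist_const => c ac; rewrite dist2_edges.
have dTA' : same_dist vT vA'
  by apply: same_dist_const => c /dist2_tent[e _ _]; exact: e.
have dTB : same_dist vT vB
  by apply: same_dist_const => c /dist2_tent[_ e _]; exact: e.
have dTC : same_dist vT vC
  by apply: same_dist_const => c /dist2_tent[_ _ e]; exact: e.
move=> li lj; move: sF li lj; rewrite !in_cons in_nil orbF.
case/orP => [/eqP->|].
  exact: (same_dist_face dAB dBC dAC).
case/orP => [/eqP->|].
  exact: (same_dist_face (same_distC dBA') dBC'' (same_distC dC''A')).
case/orP => [/eqP->|].
  exact: (same_dist_face (same_distC dBC'') dBD dC''D).
case/orP => [/eqP->|].
  exact: (same_dist_face (same_distC dBD) (same_distC dAB) (same_distC dAD)).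
case/orP => [/eqP->|].
  exact: (same_dist_face dAB' dB'C dAC).
case/orP => [/eqP->|].
  exact: (same_dist_face (same_distC dB'C) dB'A' dCA').
case/orP => [/eqP->|].
  exact: (same_dist_face (same_distC dB'A') dB'C'' (same_distC dC''A')).
case/orP => [/eqP->|].
  exact: (same_dist_face (same_distC dB'C'') dB'D dC''D).
case/orP => [/eqP->|].
  exact: (same_dist_face (same_distC dB'D) (same_distC dAB') (same_distC dAD)).
case/orP => [/eqP->|].
  exact: (same_dist_face dTB dBA' dTA').
case/orP => [/eqP->|].
  exact: (same_dist_face dTC dCA' dTA').
move=> /eqP->; exact: (same_dist_face dTC (same_distC dBC) dTB).
Qed.

End Configuration.

(** * The motion *)

Section Motion.
Variable R : realType.
Implicit Type t : R.

Definition mx t : R := 25 + t.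
Definition my t : R := -125 / mx t.
(** On admissible parameters the quantities M, N, Q, W are p^2 + h^2, q^2 + (h - k)^2, h (h - k) and
    p q, expressed through x and y. *)
Definition mM t : R := 1275 - mx t ^+ 2 - my t ^+ 2.
Definition mN t : R := 3375 - mx t ^+ 2 - 25 * my t ^+ 2.
Definition mQ t : R := 1325 - mx t ^+ 2.
Definition mW t : R := 575 - 5 * my t ^+ 2.
Definition mS t : R := mM t * mN t + mQ t ^+ 2 - mW t ^+ 2.
Definition mdisc t : R := mS t ^+ 2 - 4 * mN t * mM t * mQ t ^+ 2.
(** The sign of the root here and the negative sign of [mh] select the branch with h = -20 at time
    0. *)
Definition mH t : R := (mS t + Num.sqrt (mdisc t)) / (2 * mN t).
Definition mh t : R := - Num.sqrt (mH t).
Definition mp t : R := Num.sqrt (mM t - mH t).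
Definition mq t : R := mW t / mp t.
Definition mk t : R := mh t - mQ t / mh t.

Definition motion t : params R := Params (mx t) (my t) (mp t) (mq t) (mh t) (mk t).

(** Under these conditions the roots and quotients in [motion] are genuine and k is nonzero. All are
    strict inequalities, so they persist near a regular time. *)
Definition regular t : Prop :=
  [/\ 0 < mx t, 0 < mN t, 0 < mdisc t, 0 < mH t & 0 < mM t - mH t /\ 0 < mk t].

(* The relations of [admissible] are equivalent, for nonzero p and h, to
   p^2 = M - h^2, q = W / p, k = h - Q / h and the quadratic equation
   N H^2 - S H + M Q^2 = 0 for H = h^2. *)
Lemma motion_admissible t : regular t -> admissible (motion t).
Proof.
move=> [x0 N0 d0 H0 [MH0 k0]].
have h2 : mh t ^+ 2 = mH t by rewrite /mh sqrrN sqr_sqrtr// ltW.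
have p2 : mp t ^+ 2 = mM t - mH t by rewrite /mp sqr_sqrtr// ltW.
have hn0 : mh t != 0 by rewrite oppr_eq0 sqrtr_eq0 -ltNge.
have pn0 : mp t != 0 by rewrite sqrtr_eq0 -ltNge.
(* Completing the square: 4 N times the left side is (2 N H - S)^2 minus the discriminant. *)
have quad : mN t * mH t ^+ 2 - mS t * mH t + mM t * mQ t ^+ 2 = 0.
  have : Num.sqrt (mdisc t) ^+ 2 = mdisc t by rewrite sqr_sqrtr// ltW.
  have : Num.sqrt (mdisc t) = 2 * mN t * mH t - mS t.
    by rewrite /mH; field; rewrite gt_eqF.
  move=> -> e; apply: (mulfI (_ : 4 * mN t != 0)).
    by rewrite mulf_neq0// gt_eqF.
  by rewrite mulr0; move: e; rewrite /mdisc => e; lra.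
have NE : mW t ^+ 2 / (mM t - mH t) + mQ t ^+ 2 / mH t = mN t.
  apply: (mulIf (_ : (mM t - mH t) * mH t != 0)).
    by rewrite mulf_neq0// gt_eqF.
  transitivity (mW t ^+ 2 * mH t + mQ t ^+ 2 * (mM t - mH t)).
    by field; rewrite !gt_eqF.
  by move: quad; rewrite /mS; lra.
have q2 : mq t ^+ 2 = mW t ^+ 2 / (mM t - mH t) by rewrite /mq exprMn exprVn p2.
have hk : mh t - mk t = mQ t / mh t by rewrite /mk; ring.
have hk2 : (mh t - mk t) ^+ 2 = mQ t ^+ 2 / mH t by rewrite hk exprMn exprVn h2.
have k2 : mk t ^+ 2 = mH t - 2 * mQ t + mQ t ^+ 2 / mH t.
  by rewrite -h2 /mk; field.
have xy : mx t * my t = -125 by rewrite /my mulrC divfK// gt_eqF.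
split=> /=.
- exact: xy.
- by rewrite h2 p2 /mM; ring.
- transitivity (mx t ^+ 2 + 25 * my t ^+ 2 + mN t); last by rewrite /mN; ring.
  by rewrite hk2 q2 -NE; ring.
- transitivity (26 * my t ^+ 2 + mM t + mN t - 2 * mQ t).
    by rewrite q2 p2 k2 -NE; ring.
  by rewrite /mM /mN /mQ; ring.
- split; last by rewrite gt_eqF.
  have -> : mp t * mq t = mW t by rewrite /mq mulrC divfK.
  by rewrite /mW; ring.
Qed.

Lemma motion0 : [/\ regular 0, mx 0 = 25, my 0 = -5, mp 0 = 15 & mq 0 = 30]
  /\ [/\ mh 0 = -20 & mk 0 = 15].
Proof.
have x0 : mx 0 = 25 by rewrite /mx addr0.
have y0 : my 0 = -5 by rewrite /my x0; lra.
have M0 : mM 0 = 625 by rewrite /mM x0 y0; lra.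
have N0 : mN 0 = 2125 by rewrite /mN x0 y0; lra.
have Q0 : mQ 0 = 700 by rewrite /mQ x0; lra.
have W0 : mW 0 = 450 by rewrite /mW y0; lra.
have S0 : mS 0 = 2585 * 625 by rewrite /mS M0 N0 Q0 W0; lra.
(* The discriminant is a perfect square at time 0, and so are H and M - H; hence the integral
   starting position. *)
have d0 : mdisc 0 = (135 * 625) ^+ 2 by rewrite /mdisc S0 M0 N0 Q0; lra.
have sd0 : Num.sqrt (mdisc 0) = 135 * 625.
  by rewrite d0 sqrtr_sqr ger0_norm ?mulr_ge0 ?ler0n.
have H0 : mH 0 = 20 ^+ 2 by rewrite /mH S0 sd0 N0; lra.
have h0 : mh 0 = -20 by rewrite /mh H0 sqrtr_sqr ger0_norm ?ler0n.
have p0 : mp 0 = 15.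
  have -> : mp 0 = Num.sqrt (15 ^+ 2) by rewrite /mp M0 H0; congr Num.sqrt; lra.
  by rewrite sqrtr_sqr ger0_norm ?ler0n.
have q0 : mq 0 = 30 by rewrite /mq W0 p0; lra.
have k0 : mk 0 = 15 by rewrite /mk h0 Q0; lra.
split; split=> //; rewrite /regular x0 N0 d0 H0 M0 k0.
by split; [lra|lra|apply: exprn_gt0; lra|apply: exprn_gt0; lra|split; lra].
Qed.

Section At.
Variables (t : R) (rt : regular t).

Let x0 : mx t != 0. Proof. by case: rt => x _ _ _ _; rewrite gt_eqF. Qed.
Let N0 : 2 * mN t != 0.
Proof. by case: rt => _ N _ _ _; rewrite gt_eqF// mulr_gt0. Qed.
Let h0 : mh t != 0.
Proof. by case: rt => _ _ _ H _; rewrite oppr_eq0 sqrtr_eq0 -ltNge. Qed.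
Let p0 : mp t != 0.
Proof. by case: rt => _ _ _ _ [H _]; rewrite sqrtr_eq0 -ltNge. Qed.

Let cst (a : R) : {for t, continuous (fun=> a)}.
Proof. exact: cont_cst. Qed.

Let cx : {for t, continuous mx}.
Proof.
have cid : {for t, continuous (fun s : R => s)} by exact: cvg_id.
exact: (cont_add (@cst 25) cid).
Qed.

Let cy : {for t, continuous my}.
Proof. exact: (cont_mul (@cst (-125)) (cont_inv cx x0)). Qed.

Let cx2 := cont_opp (cont_sqr cx).

Let cy2 := cont_sqr cy.

Let cM : {for t, continuous mM}.
Proof. exact: (cont_add (cont_add (@cst 1275) cx2) (cont_opp cy2)). Qed.

Let cN : {for t, continuous mN}.
Proof.
exact: (cont_add (cont_add (@cst 3375) cx2)
  (cont_opp (cont_mul (@cst 25) cy2))).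
Qed.

Let cQ : {for t, continuous mQ}.
Proof. exact: (cont_add (@cst 1325) cx2). Qed.

Let cW : {for t, continuous mW}.
Proof. exact: (cont_add (@cst 575) (cont_opp (cont_mul (@cst 5) cy2))). Qed.

Let cS : {for t, continuous mS}.
Proof.
exact: (cont_add (cont_add (cont_mul cM cN) (cont_sqr cQ)) (cont_opp (cont_sqr cW))).
Qed.

Let cd : {for t, continuous mdisc}.
Proof.
exact: (cont_add (cont_sqr cS) (cont_opp
  (cont_mul (cont_mul (cont_mul (@cst 4) cN) cM) (cont_sqr cQ)))).
Qed.

Let cH : {for t, continuous mH}.
Proof.
exact: (cont_mul (cont_add cS (cont_sqrt cd)) (cont_inv (cont_mul (@cst 2) cN) N0)).
Qed.

Let cMH : {for t, continuous (fun s => mM s - mH s)}.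
Proof. exact: (cont_add cM (cont_opp cH)). Qed.

Let ch : {for t, continuous mh}.
Proof. exact: (cont_opp (cont_sqrt cH)). Qed.

Let cp : {for t, continuous mp}.
Proof. exact: (cont_sqrt cMH). Qed.

Let cq : {for t, continuous mq}.
Proof. exact: (cont_mul cW (cont_inv cp p0)). Qed.

Let ck : {for t, continuous mk}.
Proof. exact: (cont_add ch (cont_opp (cont_mul cQ (cont_inv ch h0)))). Qed.

Lemma near_regular : \forall s \near t, regular s.
Proof.
have [xp Np dp Hp [MHp kp]] := rt.
have gt (f : R -> R) : {for t, continuous f} -> 0 < f t -> \forall s \near t, 0 < f s.
  by move=> cf f0; exact: (cvgr_gt _ cf).
have h1 := gt _ cx xp; have h2 := gt _ cN Np; have h3 := gt _ cd dp.
have h4 := gt _ cH Hp; have h5 := gt _ cMH MHp; have h6 := gt _ ck kp.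
apply: filterS2 (filterI h1 (filterI h2 h3)) (filterI h4 (filterI h5 h6)).
by move=> s [? [? ?]] [? [? ?]]; split.
Qed.

Lemma continuous_motion i : {for t, continuous (fun s => pos (motion s) i)}.
Proof.
by apply: continuous_pos => //; exact: motion_admissible.
Qed.

End At.

End Motion.

(** * The starting position and its flex *)

Section Start.
Variable R : realType.

Definition start : params R := motion 0.

Lemma start_admissible : admissible start.
Proof. by apply: motion_admissible; case: (@motion0 R) => -[]. Qed.

Lemma startE : [/\ px start = 25, py start = -5, pp start = 15 & pq start = 30]
  /\ [/\ ph start = -20 & pk start = 15].
Proof. by case: (@motion0 R) => -[]. Qed.

Lemma start_posE :
  [/\ posA start = pt (-5) 15 0, posB start = pt 25 0 (-20),
      posA' start = pt 5 (-15) 0 & posB' start = pt (-25) 0 (-20)] /\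
  [/\ posC start = pt (-25) 30 15, posC'' start = pt 25 3 26,
      posD start = pt 5 0 5 & posT start = pt 50 (-3) 54].
Proof.
have [[x0 y0 p0 q0] [h0 k0]] := startE.
rewrite /posA /posB /posA' /posB' /posC /posC'' /posD /posT /posB /mirror /posC'.
rewrite x0 y0 p0 q0 h0 k0 opprK; split; split=> //.
- by apply: eq_pt; lra.
- rewrite /reflection !ptB !dot_pt ptZ ptB.
  by apply: eq_pt; field.
- by apply: eq_pt; field.
- by apply: eq_pt; field.
Qed.

Lemma start_vertex i j : pos start i 0 j =
  Zto R (nth 0 (nth [::] tent_vertices i) j).
Proof.
have [[eA eB eA' eB'] [eC eC'' eD eT]] := start_posE.
have row3 u a b c (z : seq Z) : u = pt a b c -> a = Zto R (nth 0 z 0) ->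
    b = Zto R (nth 0 z 1) -> c = Zto R (nth 0 z 2) -> u 0 j = Zto R (nth 0 z j).
  move=> -> -> -> ->; rewrite mxE.
  by case: j => -[|[|[|j]]] j3.
case: i => -[|[|[|[|[|[|[|[|k]]]]]]]] i8.
- exact: (row3 _ _ _ _ [:: -5; 15; 0] eA).
- exact: (row3 _ _ _ _ [:: 25; 0; -20] eB).
- exact: (row3 _ _ _ _ [:: 5; -15; 0] eA').
- exact: (row3 _ _ _ _ [:: -25; 0; -20] eB').
- exact: (row3 _ _ _ _ [:: -25; 30; 15] eC).
- exact: (row3 _ _ _ _ [:: 25; 3; 26] eC'').
- exact: (row3 _ _ _ _ [:: 5; 0; 5] eD).
- exact: (row3 _ _ _ _ [:: 50; -3; 54] eT).
- by [].
Qed.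

Lemma start_certified : all (cert_check (coords (pos start))) tent_certificates.
Proof.
rewrite (_ : coords _ = fun i j => Zto R (tent_coord i j)).
  exact: tent_certificates_check.
apply/funext => i; apply/funext => j.
by rewrite /coords start_vertex /inord !val_insubd.
Qed.

Lemma start_not_collinear :
  ~ collinear [set posA start; posB start; posA' start; posB' start].
Proof.
have [[x0 y0 p0 q0] [h0 k0]] := startE.
move=> [a [u [_ sub]]].
have [t1 _ e1] := sub (posA start) ltac:(by left; left; left).
have [t2 _ e2] := sub (posA' start) ltac:(by left; right).
have [t3 _ e3] := sub (posB start) ltac:(by left; left; right).
have coord t v (k : 'I_3) : a + t *: u = v -> a 0 k + t * u 0 k = v 0 k.
  by move=> <-; rewrite !mxE.
have := coord _ _ (inord 0) e1; have := coord _ _ (inord 0) e2.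
have := coord _ _ (inord 2) e1; have := coord _ _ (inord 2) e2.
have := coord _ _ (inord 2) e3; rewrite !mxE !inordK//= [my 0]y0 [mh 0]h0.
set v := u 0 (inord 2); set w := u 0 (inord 0) => f3 f2 f1 g2 g1.
(* A and A' are distinct and both at height 0, so a line through them is horizontal, whereas B has
   height -20. *)
have tw : (t1 - t2) * w = -10 by lra.
have /eqP : (t1 - t2) * v = 0 by lra.
rewrite mulf_eq0 => /orP[/eqP t12|/eqP v0].
  by move: tw; rewrite t12 mul0r; lra.
by move: f3 f1; rewrite v0 !mulr0; lra.
Qed.

Lemma half_turn_pt a b c : half_turn 0 (pt 0 0 1) (pt a b c) = pt (- a) (- b) c :> E3 R.
Proof.
rewrite /half_turn subr0 add0r !dot_pt !ptZ ptB.
by apply: eq_pt; field.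
Qed.

Lemma start_tetrahedron : tetrahedron (pos start) (vT |: [set vC; vB; vA'])%SET.
Proof.
have -> : (vT |: [set vC; vB; vA'])%SET = face 8 [:: 7; 4; 1; 2]%N.
  by apply/setP => i; rewrite !inE -!val_eqE /= !orbA.
split; first by rewrite card_face.
have sumE (V : nmodType) (F : 'I_8 -> V) :
    \sum_(i in face 8 [:: 7; 4; 1; 2]%N) F i = F vT + F vC + F vB + F vA'.
  rewrite (bigD1 vT) ?inE//= (bigD1 vC) ?inE//= (bigD1 vB) ?inE//=.
  rewrite (bigD1 vA') ?inE//= big1 ?addr0 ?addrA// => i.
  by rewrite inE -!val_eqE /= !inE => /andP[/andP[/andP[/andP[]]]]; do 4!case: eqP.
move=> l; rewrite !sumE => l0 lp.
have [[_ eB eA' _] [eC _ _ eT]] := start_posE.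
have : l vT *: posT start + l vC *: posC start + l vB *: posB start +
    l vA' *: posA' start = pt 0 0 0.
  by rewrite [LHS]lp; apply/rowP => -[[|[|[|k]]] k3]; rewrite !mxE.
rewrite eB eA' eC eT !ptZ !ptD => /pt_inj[f0 f1 f2].
have lT : l vT = 0 by lra.
have lC : l vC = 0 by lra.
have lB : l vB = 0 by lra.
have lA' : l vA' = 0 by lra.
move=> i; rewrite inE !in_cons in_nil orbF.
by move=> /or4P[] /eqP i8; [rewrite -lT|rewrite -lC|rewrite -lB|rewrite -lA'];
  congr l; apply/val_inj.
Qed.

Lemma start_embedded : embedded (complex 8 tent_faces) (pos start).
Proof.
exact: certified_embedded tent_faces_adjacent tent_pairs_certified start_certified.
Qed.

Lemma start_flexible : flexible (complex 8 tent_faces) (pos start).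
Proof.
have r0 : regular (0 : R) by case: (@motion0 R) => -[].
have near0 : \forall t \near (0 : R), regular t /\
    all (cert_check (coords (pos (motion t)))) tent_certificates.
  apply: filterI; first exact: near_regular.
  apply: (@near_all _ _ _ (fun t => cert_check (coords (pos (motion t)))) _ _ _
    start_certified) => y.
  apply: (near_cert_check (q := fun t => pos (motion t))) => i.
  exact: continuous_motion.
have /nbhs_ballP[e /= e0 he] := near0.
(* Half the radius keeps the closed interval from 0 to [d] inside the open ball; time is then
   rescaled by [d]. *)
pose d := e / 2.
have d0 : 0 < d by rewrite divr_gt0.
have good (s : R) : 0 <= s <= 1 -> regular (d * s) /\
    all (cert_check (coords (pos (motion (d * s))))) tent_certificates.
  move=> /andP[s0 s1]; apply: he; rewrite /ball/= sub0r normrN.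
  have ds : d * s <= d by rewrite ler_piMr// ltW.
  have de : d < e by rewrite /d; lra.
  by rewrite ger0_norm ?(le_lt_trans ds de)// mulr_ge0// ltW.
exists (fun s => pos (motion (d * s))); split.
- by move=> i; rewrite mulr0.
- move=> i; apply: continuous_in_subspaceT => s; rewrite inE /= in_itv/= => s01.
  have cds : {for s, continuous (fun s : R => d * s)}.
    by apply: cont_mul; [exact: cont_cst | exact: cvg_id].
  have [rs _] := good s s01.
  exact: (continuous_comp cds (continuous_motion rs (i := i))).
- move=> s i j s01 /same_dist_edge; apply; last exact: start_admissible.
  by apply: motion_admissible; have [] := good s s01.
- move=> s s01; have [_ chk] := good s s01.
  exact: certified_embedded tent_faces_adjacent tent_pairs_certified chk.
(* BB' is a diagonal of length 2x, and x = 25 + t strictly increases along the motion. *)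
exists 1, vB, vB'; split; first by rewrite ler01 lexx.
have dist_BB' t : 0 <= mx t ->
    eucl_dist (pos (motion t) vB) (pos (motion t) vB') = 2 * mx t.
  move=> x0; rewrite -[eucl_dist _ _]/(eucl_dist (posB (motion t)) (posB' (motion t))).
  rewrite eucl_distE dist2_pt /= (_ : _ + _ = (2 * mx t) ^+ 2); last by ring.
  by rewrite sqrtr_sqr ger0_norm// mulr_ge0// ler0n.
rewrite /start !dist_BB' /mx ?mulr1; lra.
Qed.

End Start.

Theorem mainTheorem2 (R : realType) :
  exists A B A' B' D C' C C'' T : E3 R,
    (~ collinear [set A; B; A'; B'] /\
     eucl_dist A B = eucl_dist A' B' /\ eucl_dist A' B = eucl_dist A B') /\
    (D <> A' /\ eucl_dist D B = eucl_dist B A' /\ eucl_dist D B' = eucl_dist B' A') /\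
    (ray A D C' /\ segment A C' D) /\
    (exists a u : E3 R,
       u != 0 /\ swaps (half_turn a u) A A' /\ swaps (half_turn a u) B B' /\
       C = half_turn a u C') /\
    (exists a m : E3 R,
       m != 0 /\ plane a m B /\ plane a m B' /\
       swaps (reflection a m) D A' /\ C'' = reflection a m C') /\
    (let p := positions A B A' B' C C'' D T in
     exists F : {set 'I_8},
       F \in bipyramid /\ tetrahedron p (vT |: F)%SET /\
       let Shat := tent bipyramid F vT in
       #|finset.cover Shat| = 8%N /\ #|Shat| = 12%N /\
       triangulated_sphere R Shat /\ embedded Shat p /\ flexible Shat p).
Proof.
pose c := start R.
have ac : admissible c := start_admissible R.
have [[x0 y0 p0 q0] [h0 k0]] := startE R.
have dE := dist2_edges ac.
exists (posA c), (posB c), (posA' c), (posB' c), (posD c), (posC' c), (posC c),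
  (posC'' c), (posT c).
have m0 := mirror_neq0 ac.
split.
  split; first exact: start_not_collinear.
  by rewrite !eucl_distE !(dist2C (posA' c)) !dE.
split.
  split; last by rewrite !eucl_distE !(dist2C (posD c)) !dE.
  move=> /pt_inj[]; rewrite p0 q0 y0 => _; lra.
split.
  split.
    split; first by apply/eqP => /pt_inj[]; rewrite y0; lra.
    (* D divides AC' in the ratio 1 to 2, whence the parameters 3 on the ray and 1/3 on the
       segment. *)
    exists 3; first by rewrite ler0n.
    by rewrite ptB ptZ ptD; apply: eq_pt; field.
  exists 3^-1; first by rewrite /= ; lra.
  by rewrite ptB ptZ ptD; apply: eq_pt; field.
split.
  exists 0, (pt 0 0 1); split.
    by apply/eqP => /rowP/(_ (inord 2)); rewrite !mxE inordK//= => /eqP; rewrite oner_eq0.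
  split; first by rewrite /swaps !half_turn_pt !opprK.
  by rewrite /swaps !half_turn_pt !opprK oppr0.
split.
  exists (posB c), (mirror c); split=> //.
  split; first by rewrite /plane /= subrr dot0l.
  split; first by rewrite /plane /= ptB dot_pt; ring.
  by split=> //; split; [exact: mirrorD | exact: mirrorA'].
(* The tent replaces CBA', the face through which the bipyramid intersects itself. *)
move=> p; exists [set vC; vB; vA']%SET; rewrite tent_bipyramidE.
split; first by rewrite bipyramidE face3 face_complex.
split; first exact: start_tetrahedron.
split; first by rewrite cover_complex// cardsT card_ord.
split; first by rewrite card_complex.
split; first exact: tent_faces_sphere.
by split; [exact: start_embedded | exact: start_flexible].
Qed.
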